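(* Let $X=(X_t)_{t\in[0,1]}$ be the random signed Takagi--Landsberg bridge of index $1/2$. For every fixed deterministic refining sequence $\pi=(\pi_m)_{m\ge1}$ of finite partitions of $[0,1]$ with vanishing mesh (i.e. $\pi_m\subseteq\pi_{m+1}$ for all $m$ and $\operatorname{mesh}(\pi_m)\to0$), there is an event $\Omega_\pi$ with $\mathbb P(\Omega_\pi)=1$ such that, for every $\omega\in\Omega_\pi$, $$\lim_{m\to\infty}\ \sup_{t\in[0,1]}\left|[X(\omega)]_{(\pi_m)}(t)-t\right|=0 .$$
   Context: Faber--Schauder functions: for $n\ge0$ and $0\le k<2^n$, $e_{n,k}(t)=2^{-n/2}e_{0,0}(2^nt-k)$, where $e_{0,0}(u)=\max\{0,\min(u,1-u)\}$. Let $\{\theta_{n,k}:n\ge0,\ 0\le k<2^n\}$ be independent Rademacher random variables on a probability space $(\Omega,\mathcal F,\mathbb P)$, i.e. $\mathbb P(\theta_{n,k}=1)=\mathbb P(\theta_{n,k}=-1)=1/2$. The random signed Takagi--Landsberg bridge of index $1/2$ is $$X_t=\sum_{n=0}^\infty\sum_{k=0}^{2^n-1}\theta_{n,k}e_{n,k}(t),\qquad 0\le t\le1,$$ where the series converges uniformly in $t$ for every choice of signs. A finite partition of $[0,1]$ is a set $\tau=\{0=t_0<t_1<\cdots<t_N=1\}$, and $\operatorname{mesh}(\tau)=\max_{0\le i<N}(t_{i+1}-t_i)$. For a continuous path $x$ on $[0,1]$, the stopped quadratic sums are $$[x]_{(\tau)}(t)=\sum_{i=0}^{N-1}\bigl(x(t_{i+1}\wedge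 t)-x(t_i\wedge t)\bigr)^2,\qquad 0\le t\le1 .$$ *)

(* Defs.v *)
From HB Require Import structures.
From mathcomp Require Import all_boot all_order all_algebra finmap.
From mathcomp Require Import all_classical all_reals all_analysis.
Import Order.TTheory GRing.Theory Num.Theory.
Import numFieldNormedType.Exports.

Set Implicit Arguments.
Unset Strict Implicit.
Unset Printing Implicit Defensive.

Local Open Scope classical_set_scope.
Local Open Scope ring_scope.

Section faber_schauder.
Context {R : realType}.

Definition tent (u : R) : R := Num.max 0 (Num.min u (1 - u)).

Definition faber_schauder (n k : nat) (t : R) : R :=
  2 `^ (- (n%:R / 2)) * tent (2 ^+ n * t - k%:R).

End faber_schauder.

Section rademacher.
Context {d : measure_display} {T : measurableType d} {R : realType}.
Context (P : probability T R).

Definition rademacher (X : {RV P >-> R}) : Prop :=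
  P (X @^-1` [set 1]) = (2^-1)%:E /\ P (X @^-1` [set -1]) = (2^-1)%:E.

Definition mutually_independent (I : choiceType) (X : I -> {RV P >-> R}) : Prop :=
  forall (J : {fset I}) (B : I -> set R), (forall i, measurable (B i)) ->
    P (\bigcap_(i in [set` J]) (X i @^-1` B i)) =
    (\prod_(i <- J) P (X i @^-1` B i))%E.

Definition independent_rademacher
    (theta : forall n : nat, 'I_(2 ^ n)%N -> {RV P >-> R}) : Prop :=
  (forall n k, rademacher (theta n k)) /\
  mutually_independent
    (fun i : {n : nat & 'I_(2 ^ n)%N} => theta (tag i) (tagged i)).

(* The levels n are summed in order; the limit exists, uniformly in t, as soon
   as all the theta n k w are signs, hence for almost every w. *)
Definition takagi_landsberg
    (theta : forall n : nat, 'I_(2 ^ n)%N -> {RV P >-> R}) (w : T) (t : R) : R :=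
  limn (series (fun n : nat =>
    \sum_(k < (2 ^ n)%N) theta n k w * faber_schauder n k t)).

End rademacher.

Section partitions.
Context {R : realType}.

(* As in itv_partition 0 1 s, the partition 0 = t_0 < t_1 < ... < t_N = 1 is
   represented by s = [:: t_1; ...; t_N], so that t_i = (0 :: s)`_i. *)

Definition mesh (s : seq R) : R :=
  \big[Num.max/0]_(0 <= i < size s) ((0 :: s)`_i.+1 - (0 :: s)`_i).

Definition stopped_quadratic_sum (x : R -> R) (s : seq R) (t : R) : R :=
  \sum_(0 <= i < size s)
    (x (Num.min (0 :: s)`_i.+1 t) - x (Num.min (0 :: s)`_i t)) ^+ 2.

Definition refining_partitions (pi : nat -> seq R) : Prop :=
  [/\ forall m, itv_partition 0 1 (pi m),
      forall m, {subset 0 :: pi m <= 0 :: pi m.+1}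
    & mesh (pi m) @[m --> \oo] --> (0 : R)].

End partitions.

(* Main.v *)
Require Import Defs.
From HB Require Import structures.
From mathcomp Require Import all_boot all_order all_algebra finmap.
From mathcomp Require Import all_classical all_reals all_analysis.
From mathcomp Require Import ring lra zify.
Import Order.TTheory GRing.Theory Num.Theory.
Import numFieldNormedType.Exports.
Local Open Scope classical_set_scope.
Local Open Scope ring_scope.
Set Implicit Arguments.
Unset Strict Implicit.
Unset Printing Implicit Defensive.

(** Fix a time [t] and a partition. The stopped quadratic sum is a quadratic
    form in the signs, with matrix [gram]. Since the squares of the signs are
    [1], its diagonal part is deterministic: it is the variance of the bridge
    summed over the intervals, namely [t] minus the sum [S] of the squared
    lengths ([increment_variance], [gram_trace]), and [S] vanishes with the
    mesh. It remains to show that the off-diagonal part tends to [0].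

    The pairings of the Haar functions with the indicator functions of the
    intervals are the increments of the Faber--Schauder functions; so, up to the
    constant Haar function, [gram] is the matrix in the Haar basis of the kernel
    equal to [1] on the squares [I * I], where [I] runs over the intervals. By
    Bessel's inequality ([wincr_bessel], [tensor_bessel]), if one partition
    refines another, the squared Hilbert--Schmidt norm of the difference of the
    two matrices is at most the decrease of [S]
    ([gram_refine_hilbert_schmidt]). By hypercontractivity
    ([quadratic_form_quart]), the fourth moment of the difference of the two
    off-diagonal parts is then at most a constant times the square of that
    decrease.

    The mesh may tend to [0] arbitrarily slowly, so Borel--Cantelli does not
    apply to the partitions one by one. But along the refining sequence [S]
    decreases, and the exponent [2] is larger than [1]: a chaining argument
    ([sign_mean_maximal]) bounds the maximum over all the partitions after the
    [m]-th one, with a bound that depends only on [S] at [m]. This gives almost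
    sure convergence at the time [t] ([quadratic_sum_cvg_negligible]). All the
    moments are computed for the path truncated at a dyadic level, where they
    are averages over finitely many signs; only probabilities of events go to
    the limit.

    Finally, stopped quadratic sums are nondecreasing in time up to the squared
    oscillation of the path over one interval, so convergence at the rational
    times implies uniform convergence ([uniform_of_pointwise]). *)

(** * Inequalities for finite sums *)

(** Lagrange's identity: the difference of the two sides is half the sum of the
    squares [w i * w j * (a i * b j - a j * b i) ^+ 2]. *)
Lemma cauchy_schwarz_sum (R : realFieldType) (I : Type) (r : seq I)
    (w a b : I -> R) :
  (forall i, 0 <= w i) ->
  (\sum_(i <- r) w i * a i * b i) ^+ 2 <=
  (\sum_(i <- r) w i * a i ^+ 2) * (\sum_(i <- r) w i * b i ^+ 2).
Proof.
move=> w0; rewrite -subr_ge0.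
suff -> : (\sum_(i <- r) w i * a i ^+ 2) * (\sum_(i <- r) w i * b i ^+ 2) -
   (\sum_(i <- r) w i * a i * b i) ^+ 2 =
   2^-1 * \sum_(i <- r) \sum_(j <- r) w i * w j * (a i * b j - a j * b i) ^+ 2.
  rewrite mulr_ge0 ?invr_ge0 ?ler0n //; apply: sumr_ge0 => i _; apply: sumr_ge0 => j _.
  by rewrite mulr_ge0 ?sqr_ge0 ?mulr_ge0.
have E : \sum_(i <- r) \sum_(j <- r) w i * w j * (a i * b j - a j * b i) ^+ 2 =
  (\sum_(i <- r) w i * a i ^+ 2) * (\sum_(i <- r) w i * b i ^+ 2) +
  (\sum_(i <- r) w i * b i ^+ 2) * (\sum_(i <- r) w i * a i ^+ 2) -
  2 * ((\sum_(i <- r) w i * a i * b i) * (\sum_(i <- r) w i * a i * b i)).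
  rewrite !big_distrlr /= mulr_sumr -big_split -sumrB /=.
  apply: eq_bigr => i _; rewrite mulr_sumr -big_split -sumrB /=.
  by apply: eq_bigr => j _; ring.
by rewrite E; field.
Qed.

(** * Polynomials of degree two in independent signs *)

Section SignMean.
Context {R : realFieldType} {I : finType}.
Implicit Types (f g h : {ffun I -> bool} -> R) (e : {ffun I -> bool}).

Definition sign_mean f : R := (\sum_e f e) / #|{ffun I -> bool}|%:R.

Definition sgn_of (b : bool) : R := if b then 1 else -1.

Definition flip (a : I) e : {ffun I -> bool} :=
  [ffun i => if i == a then ~~ e i else e i].

Lemma card_signs_gt0 : 0 < #|{ffun I -> bool}|%:R :> R.
Proof. by rewrite ltr0n; apply/card_gt0P; exists [ffun=> true]. Qed.

Lemma sqr_sgn_of b : sgn_of b ^+ 2 = 1.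
Proof. by case: b; rewrite /= ?sqrrN expr1n. Qed.

Lemma sign_meanD f g : sign_mean (fun e => f e + g e) = sign_mean f + sign_mean g.
Proof. by rewrite /sign_mean big_split /= mulrDl. Qed.

Lemma sign_meanZ c f : sign_mean (fun e => c * f e) = c * sign_mean f.
Proof. by rewrite /sign_mean -mulr_sumr mulrA. Qed.

Lemma sign_mean_cst c : sign_mean (fun=> c) = c.
Proof.
rewrite /sign_mean sumr_const -[c *+ _]mulr_natr mulfK //.
by rewrite gt_eqF // card_signs_gt0.
Qed.

Lemma eq_sign_mean f g : f =1 g -> sign_mean f = sign_mean g.
Proof. by move=> fg; rewrite /sign_mean (eq_bigr g). Qed.

Lemma le_sign_mean f g : (forall e, f e <= g e) -> sign_mean f <= sign_mean g.
Proof.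
by move=> fg; rewrite ler_pM2r ?invr_gt0 ?card_signs_gt0 //; apply: ler_sum.
Qed.

Lemma sign_mean_ge0 f : (forall e, 0 <= f e) -> 0 <= sign_mean f.
Proof. by move=> f0; rewrite -(sign_mean_cst 0); exact: le_sign_mean. Qed.

(** Markov's inequality. *)
Lemma sign_mean_markov f c : (forall e, 0 <= f e) -> 0 < c ->
  #|[set e | c < f e]%SET|%:R / #|{ffun I -> bool}|%:R <= sign_mean f / c.
Proof.
move=> f0 c0; rewrite ler_pdivlMr // mulrAC ler_pM2r ?invr_gt0 ?card_signs_gt0 //.
rewrite mulrC mulr_natr -sumr_const [leRHS](bigID (mem [set e | c < f e]%SET)) /=.
rewrite -[leLHS]addr0 lerD //; last exact: sumr_ge0.
by apply: ler_sum => e; rewrite inE => /ltW.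
Qed.

Lemma sign_mean_cauchy_schwarz f g :
  sign_mean (fun e => f e * g e) ^+ 2 <=
  sign_mean (fun e => f e ^+ 2) * sign_mean (fun e => g e ^+ 2).
Proof.
rewrite /sign_mean mulrACA exprMn -[in leRHS]expr2 ler_wpM2r ?sqr_ge0 //.
have := @cauchy_schwarz_sum R _ (index_enum {ffun I -> bool}) (fun=> 1) f g
  (fun=> ler01).
congr (_ ^+ 2 <= _ * _); first by apply: eq_bigr => e _; rewrite mul1r.
  by apply: eq_bigr => e _; rewrite mul1r.
by apply: eq_bigr => e _; rewrite mul1r.
Qed.

Lemma flipK a : involutive (flip a).
Proof. by move=> e; apply/ffunP => i; rewrite !ffunE; case: eqP => // _; rewrite negbK. Qed.

(** Flipping one sign preserves the uniform measure. *)
Lemma sign_mean_odd a f : (forall e, f (flip a e) = - f e) -> sign_mean f = 0.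
Proof.
move=> fN; suff : sign_mean f = - sign_mean f.
  by move/eqP; rewrite -addr_eq0 -mulr2n mulrn_eq0 => /eqP.
rewrite {1}/sign_mean (reindex_inj (inv_inj (flipK a))) /=.
by under eq_bigr do rewrite fN; rewrite sumrN mulNr.
Qed.

Lemma sgn_of_flip a e : sgn_of (flip a e a) = - sgn_of (e a).
Proof. by rewrite ffunE eqxx; case: (e a); rewrite /= ?opprK. Qed.

Lemma sgn_of_flip_neq a b e : b != a -> flip a e b = e b.
Proof. by move=> ba; rewrite ffunE (negPf ba). Qed.

Lemma sign_mean_sgnM a f : (forall e, f (flip a e) = f e) ->
  sign_mean (fun e => sgn_of (e a) * f e) = 0.
Proof. by move=> fi; apply: (@sign_mean_odd a) => e; rewrite sgn_of_flip fi mulNr. Qed.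

Section AddOneSign.
Context (a : I) (g h : {ffun I -> bool} -> R).
Hypothesis gi : forall e, g (flip a e) = g e.
Hypothesis hi : forall e, h (flip a e) = h e.

Lemma sign_mean_sqrD_sgn :
  sign_mean (fun e => (sgn_of (e a) * g e + h e) ^+ 2) =
  sign_mean (fun e => g e ^+ 2) + sign_mean (fun e => h e ^+ 2).
Proof.
rewrite -sign_meanD -[RHS]addr0.
rewrite -(@sign_mean_sgnM a (fun e => 2 * g e * h e)); last first.
  by move=> e; rewrite gi hi.
rewrite -sign_meanD; apply: eq_sign_mean => e.
transitivity (sgn_of (e a) ^+ 2 * g e ^+ 2 + h e ^+ 2 +
  sgn_of (e a) * (2 * g e * h e)); first by ring.
by rewrite sqr_sgn_of mul1r.
Qed.

Lemma sign_mean_quartD_sgn :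
  sign_mean (fun e => (sgn_of (e a) * g e + h e) ^+ 4) =
  sign_mean (fun e => g e ^+ 4) + 6 * sign_mean (fun e => g e ^+ 2 * h e ^+ 2)
  + sign_mean (fun e => h e ^+ 4).
Proof.
rewrite -sign_meanZ -!sign_meanD -[RHS]addr0.
rewrite -(@sign_mean_sgnM a
  (fun e => 4 * g e ^+ 3 * h e + 4 * g e * h e ^+ 3)); last first.
  by move=> e; rewrite gi hi.
rewrite -sign_meanD; apply: eq_sign_mean => e.
transitivity (sgn_of (e a) ^+ 2 ^+ 2 * g e ^+ 4 +
  6 * (sgn_of (e a) ^+ 2 * g e ^+ 2 * h e ^+ 2) + h e ^+ 4 +
  sgn_of (e a) * (4 * (sgn_of (e a) ^+ 2) * g e ^+ 3 * h e +
                  4 * g e * h e ^+ 3)); first by ring.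
by rewrite sqr_sgn_of expr1n !mul1r mulr1.
Qed.
End AddOneSign.

(** Chaoses are indexed by lists of signs, not by sets, so that their moments
    can be computed by adding one sign at a time. *)
Definition linear_chaos (c : I -> R) (s : seq I) e : R :=
  \sum_(b <- s) c b * sgn_of (e b).

Lemma linear_chaos_flip a c s e : a \notin s ->
  linear_chaos c s (flip a e) = linear_chaos c s e.
Proof.
move=> as_; rewrite /linear_chaos; apply: eq_big_seq => b bs.
by rewrite sgn_of_flip_neq //; apply: contraNneq as_ => <-.
Qed.

(** Khinchine's inequality with exponent 4. *)
Lemma linear_chaos_moments c s : uniq s ->
  sign_mean (fun e => linear_chaos c s e ^+ 2) = \sum_(b <- s) c b ^+ 2 /\
  sign_mean (fun e => linear_chaos c s e ^+ 4) <= 3 * (\sum_(b <- s) c b ^+ 2) ^+ 2.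
Proof.
elim: s => [_|a s IH /= /andP[as_ /IH[IH2 IH4]]].
  rewrite /linear_chaos big_nil; split.
    by rewrite -[RHS](sign_mean_cst 0); apply: eq_sign_mean => e; rewrite big_nil expr0n.
  rewrite expr0n mulr0 -[leRHS](sign_mean_cst 0); apply: le_sign_mean => e.
  by rewrite big_nil expr0n.
have E e : linear_chaos c (a :: s) e = sgn_of (e a) * c a + linear_chaos c s e.
  by rewrite /linear_chaos big_cons mulrC.
have inv e := linear_chaos_flip c e as_.
split.
  under eq_sign_mean do rewrite E.
  rewrite (sign_mean_sqrD_sgn (g := fun=> c a)) //.
  by rewrite sign_mean_cst IH2 big_cons.
under eq_sign_mean do rewrite E.
rewrite (sign_mean_quartD_sgn (g := fun=> c a)) //.
rewrite sign_mean_cst sign_meanZ IH2 big_cons.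
apply: le_trans (lerD (lexx _) IH4) _.
rewrite -subr_ge0.
set V := \sum_(b <- s) _.
suff -> : 3 * (c a ^+ 2 + V) ^+ 2 - (c a ^+ 4 + 6 * (c a ^+ 2 * V) + 3 * V ^+ 2) =
  2 * (c a ^+ 2) ^+ 2 by rewrite mulr_ge0 ?sqr_ge0.
by ring.
Qed.

Fixpoint quadratic_chaos (A : I -> I -> R) (s : seq I) e : R :=
  if s is a :: s' then sgn_of (e a) * linear_chaos (A a) s' e + quadratic_chaos A s' e
  else 0.

Fixpoint quadratic_chaos_var (A : I -> I -> R) (s : seq I) : R :=
  if s is a :: s' then \sum_(b <- s') A a b ^+ 2 + quadratic_chaos_var A s' else 0.

Lemma quadratic_chaos_flip a A s e : a \notin s ->
  quadratic_chaos A s (flip a e) = quadratic_chaos A s e.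
Proof.
elim: s => //= b s IH; rewrite inE negb_or => /andP[ab as_].
by rewrite IH // linear_chaos_flip // sgn_of_flip_neq // eq_sym.
Qed.

Lemma quadratic_chaos_var_ge0 A s : 0 <= quadratic_chaos_var A s.
Proof.
by elim: s => //= a s IH; rewrite addr_ge0 // sumr_ge0 // => b _; rewrite sqr_ge0.
Qed.

(** Bonami's hypercontractive inequality for degree two, by induction on the
    number of signs: the new sign [sgn_of (e a)] multiplies a linear form, whose
    fourth moment is known, and the mixed term is controlled by
    Cauchy--Schwarz. *)
Lemma quadratic_chaos_moments A s : uniq s ->
  sign_mean (fun e => quadratic_chaos A s e ^+ 2) = quadratic_chaos_var A s /\
  sign_mean (fun e => quadratic_chaos A s e ^+ 4) <= 81 * quadratic_chaos_var A s ^+ 2.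
Proof.
elim: s => [_|a s IH /= /andP[as_ us]].
  rewrite /=; split; first by rewrite sign_mean_cst expr0n.
  by rewrite sign_mean_cst !expr0n mulr0.
have [IH2 IH4] := IH us; have [L2 L4] := linear_chaos_moments (A a) us.
set L := linear_chaos (A a) s; set Q := quadratic_chaos A s.
have Li e : L (flip a e) = L e by apply: linear_chaos_flip.
have Qi e : Q (flip a e) = Q e by apply: quadratic_chaos_flip.
set B := \sum_(b <- s) A a b ^+ 2 in L2 L4 *; set V := quadratic_chaos_var A s in IH2 IH4 *.
have V0 : 0 <= V by exact: quadratic_chaos_var_ge0.
have B0 : 0 <= B by apply: sumr_ge0 => b _; rewrite sqr_ge0.
split; first by rewrite sign_mean_sqrD_sgn // L2 IH2.
rewrite sign_mean_quartD_sgn //.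
have mixed : sign_mean (fun e => L e ^+ 2 * Q e ^+ 2) <= 27 * B * V.
  rewrite -(@ler_pXn2r _ 2) ?nnegrE //; last 2 first.
  - by apply: sign_mean_ge0 => e; rewrite mulr_ge0 ?sqr_ge0.
  - by rewrite !mulr_ge0.
  apply: le_trans (sign_mean_cauchy_schwarz _ _) _.
  under eq_sign_mean do rewrite -exprM.
  under [X in _ * X]eq_sign_mean do rewrite -exprM.
  have -> : (27 * B * V) ^+ 2 = (9 * B ^+ 2) * (81 * V ^+ 2) by ring.
  apply: ler_pM => //; try by apply: sign_mean_ge0 => e; rewrite exprn_even_ge0.
  by apply: le_trans L4 _; rewrite ler_wpM2r ?sqr_ge0 // ler_nat.
apply: (@le_trans _ _ (3 * B ^+ 2 + 6 * (27 * B * V) + 81 * V ^+ 2)).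
  by rewrite !lerD // ler_wpM2l.
rewrite -subr_ge0.
suff -> : 81 * (B + V) ^+ 2 - (3 * B ^+ 2 + 6 * (27 * B * V) + 81 * V ^+ 2) =
  78 * B ^+ 2 by rewrite mulr_ge0 ?sqr_ge0.
by ring.
Qed.

Lemma quadratic_form_signs A s e : (forall p q, A p q = A q p) ->
  \sum_(p <- s) \sum_(q <- s) A p q * (sgn_of (e p) * sgn_of (e q)) =
  \sum_(p <- s) A p p + 2 * quadratic_chaos A s e.
Proof.
move=> Asym; elim: s => [|a s IH /=]; first by rewrite !big_nil mulr0 addr0.
rewrite !big_cons; under [X in _ + X = _]eq_bigr do rewrite big_cons.
rewrite big_split /= IH -!expr2 sqr_sgn_of mulr1.
have -> : \sum_(i <- s) A i a * (sgn_of (e i) * sgn_of (e a)) =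
    sgn_of (e a) * linear_chaos (A a) s e.
  by rewrite mulr_sumr; apply: eq_bigr => i _; rewrite Asym; ring.
have -> : \sum_(j <- s) A a j * (sgn_of (e a) * sgn_of (e j)) =
    sgn_of (e a) * linear_chaos (A a) s e.
  by rewrite mulr_sumr; apply: eq_bigr => i _; ring.
by ring.
Qed.

Lemma quadratic_chaos_var_le A s : (forall p q, A p q = A q p) ->
  2 * quadratic_chaos_var A s <= \sum_(p <- s) \sum_(q <- s) A p q ^+ 2.
Proof.
move=> Asym; elim: s => [|a s IH /=]; first by rewrite big_nil mulr0.
rewrite !big_cons; under [X in _ <= _ + X]eq_bigr do rewrite big_cons.
rewrite big_split /=.
under [X in _ <= _ + (X + _)]eq_bigr do rewrite Asym.
have := sqr_ge0 (A a a); move: IH.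
by move: (\sum_(p <- s) \sum_(q <- s) _) => ? ? ?; lra.
Qed.

(** The squares of the signs being [1], subtracting the trace leaves twice the
    quadratic chaos, whose variance is a part of the squared Hilbert--Schmidt norm
    of [A]. *)
Lemma quadratic_form_quart A : (forall p q, A p q = A q p) ->
  sign_mean (fun e => (\sum_p \sum_q A p q * (sgn_of (e p) * sgn_of (e q)) -
                       \sum_p A p p) ^+ 4)
  <= 18 ^+ 2 * (\sum_p \sum_q A p q ^+ 2) ^+ 2.
Proof.
move=> Asym; have us : uniq (index_enum I) by exact: index_enum_uniq.
under eq_sign_mean do rewrite quadratic_form_signs // addrC addKr exprMn.
rewrite sign_meanZ.
have [_ Q4] := quadratic_chaos_moments A us.
have Vle := quadratic_chaos_var_le (index_enum I) Asym.
have V0 := quadratic_chaos_var_ge0 A (index_enum I).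
set V := quadratic_chaos_var _ _ in V0 Vle Q4 *.
apply: (@le_trans _ _ (2 ^+ 4 * (81 * V ^+ 2))).
  by rewrite ler_wpM2l // exprn_ge0.
have -> : 2 ^+ 4 * (81 * V ^+ 2) = 18 ^+ 2 * (2 * V) ^+ 2 by ring.
by rewrite ler_wpM2l // ler_pXn2r ?nnegrE ?mulr_ge0 // (le_trans _ Vle) ?mulr_ge0.
Qed.

End SignMean.

(** * A maximal inequality *)

(** Convexity of [x ^+ 4], with weights [1/8] and [7/8]; what matters is that the
    constant [3/2] stays below [2]. *)
Lemma quartD_le (R : realFieldType) (a b : R) :
  (a + b) ^+ 4 <= 2 ^+ 9 * a ^+ 4 + 3 / 2 * b ^+ 4.
Proof.
have sq (x y : R) : (x + y) ^+ 2 <= 8 * x ^+ 2 + 8 / 7 * y ^+ 2.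
  rewrite -subr_ge0.
  suff -> : 8 * x ^+ 2 + 8 / 7 * y ^+ 2 - (x + y) ^+ 2 = 7^-1 * (7 * x - y) ^+ 2.
    by rewrite mulr_ge0 ?invr_ge0 ?sqr_ge0 ?ler0n.
  by field.
have -> : (a + b) ^+ 4 = ((a + b) ^+ 2) ^+ 2 by rewrite -exprM.
apply: (@le_trans _ _ ((8 * a ^+ 2 + 8 / 7 * b ^+ 2) ^+ 2)).
  rewrite ler_pXn2r ?nnegrE ?sqr_ge0 // addr_ge0 // mulr_ge0 ?sqr_ge0 ?divr_ge0 ?ler0n //.
apply: le_trans (sq _ _) _.
have -> : 8 * (8 * a ^+ 2) ^+ 2 = 2 ^+ 9 * a ^+ 4 by ring.
rewrite lerD2l.
have -> : 8 / 7 * (8 / 7 * b ^+ 2) ^+ 2 = 512 / 343 * b ^+ 4 by field.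
by rewrite ler_wpM2r ?exprn_even_ge0 //; lra.
Qed.

(** Since the increments are controlled by a power [2 > 1] of an additive
    quantity, no logarithm is lost: split the time interval where [g] has dropped
    by half. Each half carries at most a quarter of [(g i - g j) ^+ 2], so with
    [quartD_le] the constant [K] of the conclusion only has to satisfy
    [2 ^+ 9 * C + (3/2) * (K/4 + K/4) <= K]. *)
Lemma sign_mean_maximal (R : realFieldType) (I : finType)
    (Y : nat -> {ffun I -> bool} -> R) (g : nat -> R) (C : R) (i j : nat) :
  0 <= C -> (forall m n, (m <= n)%N -> g n <= g m) ->
  (forall m n, (m <= n)%N ->
     sign_mean (fun e => (Y n e - Y m e) ^+ 4) <= C * (g m - g n) ^+ 2) ->
  (i <= j)%N ->
  exists Z : {ffun I -> bool} -> R, [/\ forall e, 0 <= Z e,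
    forall e m, (i <= m <= j)%N -> (Y m e - Y i e) ^+ 4 <= Z e &
    sign_mean Z <= 2 ^+ 11 * C * (g i - g j) ^+ 2].
Proof.
move=> C0 gle Yle; have [d] := ubnP (j - i).
elim: d i j => // d IH i j jid; rewrite leq_eqVlt => /orP[/eqP <-|ij].
  exists (fun=> 0); split=> //.
    by move=> e m; rewrite -eqn_leq => /eqP ->; rewrite subrr expr0n.
  by rewrite sign_mean_cst subrr expr0n mulr0.
set h := g i - g j.
have h0 : 0 <= h by rewrite subr_ge0 gle // ltnW.
have exk : exists k, (i < k)%N && (h / 2 <= g i - g k).
  by exists j; rewrite ij /= -/h; lra.
case: (ex_minnP exk) => k /andP[ik hk] kmin.
have kj : (k <= j)%N by apply: kmin; rewrite ij -/h; lra.
have ik1 : (i <= k.-1)%N by clear -ik; lia.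
have ik1d : (k.-1 - i < d)%N by clear -ik kj jid; lia.
have kjd : (j - k < d)%N by clear -ik kj jid; lia.
have hk1 : g i - g k.-1 <= h / 2.
  have [->|nik1] := eqVneq k.-1 i; first by rewrite subrr; lra.
  rewrite leNgt; apply/negP => /ltW H.
  have /kmin : (i < k.-1)%N && (h / 2 <= g i - g k.-1).
    by rewrite H andbT ltn_neqAle eq_sym nik1.
  by clear -ik; lia.
have [Z1 [Z10 Z1P Z1m]] := IH i k.-1 ik1d ik1.
have [Z2 [Z20 Z2P Z2m]] := IH k j kjd kj.
exists (fun e => 2 ^+ 9 * (Y k e - Y i e) ^+ 4 + 3 / 2 * (Z1 e + Z2 e)); split.
- move=> e; apply: addr_ge0.
    by apply: mulr_ge0; [exact: exprn_ge0|exact: exprn_even_ge0].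
  by rewrite mulr_ge0 ?divr_ge0 ?addr_ge0.
- move=> e m /andP[im mj]; have := Z10 e; have := Z20 e.
  have : 0 <= (Y k e - Y i e) ^+ 4 by rewrite exprn_even_ge0.
  have [km|mk] := leqP k m.
    have -> : Y m e - Y i e = (Y k e - Y i e) + (Y m e - Y k e) by ring.
    have := quartD_le (Y k e - Y i e) (Y m e - Y k e).
    have := Z2P e m; rewrite km mj => /(_ isT); lra.
  have mk1 : (m <= k.-1)%N by clear -mk; lia.
  by have := Z1P e m; rewrite im mk1 => /(_ isT); lra.
rewrite sign_meanD !sign_meanZ sign_meanD.
have q1 : (g i - g k.-1) ^+ 2 <= h ^+ 2 / 4.
  have -> : h ^+ 2 / 4 = (h / 2) ^+ 2 by field.
  rewrite ler_pXn2r ?nnegrE //; last by lra.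
  by rewrite subr_ge0 gle.
have q2 : (g k - g j) ^+ 2 <= h ^+ 2 / 4.
  have -> : h ^+ 2 / 4 = (h / 2) ^+ 2 by field.
  rewrite ler_pXn2r ?nnegrE //; [|by rewrite subr_ge0 gle|]; last first.
    by lra.
  by move: hk; rewrite /h; lra.
have q3 : (g i - g k) ^+ 2 <= h ^+ 2.
  rewrite ler_pXn2r ?nnegrE //; first by rewrite /h lerD2l lerN2 gle.
  by rewrite subr_ge0 gle // ltnW.
have {}q1 : C * (g i - g k.-1) ^+ 2 <= C * h ^+ 2 / 4.
  by rewrite -mulrA ler_wpM2l.
have {}q2 : C * (g k - g j) ^+ 2 <= C * h ^+ 2 / 4 by rewrite -mulrA ler_wpM2l.
have {}q3 : C * (g i - g k) ^+ 2 <= C * h ^+ 2 by rewrite ler_wpM2l.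
have q4 := le_trans (Yle i k (ltnW ik)) q3.
move: Z1m Z2m q1 q2 q4; rewrite -!(mulrA (2 ^+ 11)).
move: (C * h ^+ 2) (C * _) (C * _) (sign_mean _) (sign_mean _) (sign_mean _).
by move=> *; lra.
Qed.

(** * Increments of the Faber--Schauder functions *)

Section FaberSchauderIncrements.
Context {R : realType}.

(** The quantity [(2 ^+ n)^-1 * unit_ramp (2 ^+ n * t - k)] is the length of the
    part of the dyadic interval [[k / 2 ^ n, k.+1 / 2 ^ n]] that lies before
    [t]. *)
Definition unit_ramp (x : R) : R := Num.max 0 (Num.min x 1).

Lemma unit_ramp_ge0 x : 0 <= unit_ramp x.
Proof. by rewrite /unit_ramp le_max lexx. Qed.

Lemma unit_ramp_le1 x : unit_ramp x <= 1.
Proof. by rewrite /unit_ramp ge_max ler01 ge_min lexx orbT. Qed.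

Lemma unit_ramp_cases x : [\/ x <= 0 /\ unit_ramp x = 0,
  0 <= x <= 1 /\ unit_ramp x = x | 1 <= x /\ unit_ramp x = 1].
Proof.
rewrite /unit_ramp; case: (lerP x 1) => x1; last first.
  by apply: Or33; split; [exact: ltW|rewrite max_r].
by case: (lerP 0 x) => x0; [apply: Or32|apply: Or31; rewrite ltW].
Qed.

Lemma tent_cases (x : R) : [\/ x <= 0 /\ tent x = 0, 0 <= 2 * x <= 1 /\ tent x = x,
  1 <= 2 * x <= 2 /\ tent x = 1 - x | 1 <= x /\ tent x = 0].
Proof.
rewrite /tent; case: (lerP x (1 - x)) => x1.
  by case: (lerP 0 x) => x0; [apply: Or42|apply: Or41]; split=> //; lra.
by case: (lerP 0 (1 - x)) => x0; [apply: Or43|apply: Or44]; split=> //; lra.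
Qed.

Lemma le_unit_ramp x y : x <= y -> unit_ramp x <= unit_ramp y.
Proof.
move=> xy; have [[? ->]|[? ->]|[? ->]] := unit_ramp_cases x;
by have [[? ->]|[? ->]|[? ->]] := unit_ramp_cases y; lra.
Qed.

Lemma unit_ramp_half x : unit_ramp x = 2^-1 * (unit_ramp (2 * x) + unit_ramp (2 * x - 1)).
Proof.
have [[? ->]|[? ->]|[? ->]] := unit_ramp_cases x;
have [[? ->]|[? ->]|[? ->]] := unit_ramp_cases (2 * x);
by have [[? ->]|[? ->]|[? ->]] := unit_ramp_cases (2 * x - 1); lra.
Qed.

Lemma tent_half (x : R) : tent x = 2^-1 * (unit_ramp (2 * x) - unit_ramp (2 * x - 1)).
Proof.
have [[? ->]|[? ->]|[? ->]|[? ->]] := tent_cases x;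
have [[? ->]|[? ->]|[? ->]] := unit_ramp_cases (2 * x);
by have [[? ->]|[? ->]|[? ->]] := unit_ramp_cases (2 * x - 1); lra.
Qed.

Lemma sum_unit_ramp (x : R) m : 0 <= x ->
  \sum_(0 <= k < m) unit_ramp (x - k%:R) = Num.min x m%:R.
Proof.
move=> x0; elim: m => [|m IH]; first by rewrite big_nil minEle; case: leP => ?; lra.
rewrite big_nat_recr //= IH -natr1; have := ler0n R m; rewrite !minEle.
by have [[? ->]|[? ->]|[? ->]] := unit_ramp_cases (x - m%:R); do !case: leP => ?; lra.
Qed.

(** For a given [x], the values [unit_ramp (x - k%:R)] are all equal to [0] or
    [1], except possibly one of them. *)
Lemma sum_unit_ramp_defect (x : R) m :
  \sum_(0 <= k < m) unit_ramp (x - k%:R) * (1 - unit_ramp (x - k%:R)) <= 1.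
Proof.
apply: (@le_trans _ _ (\sum_(0 <= k < m)
    (- unit_ramp (x - k.+1%:R) - - unit_ramp (x - k%:R)))).
  apply: ler_sum_nat => k _; rewrite -natr1.
  have [[? ->]|[? ->]|[? ->]] := unit_ramp_cases (x - k%:R);
  by have [[? ->]|[? ->]|[? ->]] := unit_ramp_cases (x - (k%:R + 1)); nra.
rewrite telescope_sumr //; have := unit_ramp_ge0 (x - m%:R).
by have := unit_ramp_le1 (x - 0%:R); lra.
Qed.

(** The translates of the tent have essentially disjoint supports. *)
Lemma sum_tent_le1 (x : R) m : \sum_(0 <= k < m) tent (x - k%:R) <= 1.
Proof.
apply: (@le_trans _ _ (\sum_(0 <= k < m)
    (- unit_ramp (x - k.+1%:R) - - unit_ramp (x - k%:R)))).
  apply: ler_sum_nat => k _; rewrite -natr1.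
  have [[? ->]|[? ->]|[? ->]|[? ->]] := tent_cases (x - k%:R);
  have [[? ->]|[? ->]|[? ->]] := unit_ramp_cases (x - k%:R);
  by have [[? ->]|[? ->]|[? ->]] := unit_ramp_cases (x - (k%:R + 1)); lra.
rewrite telescope_sumr //; have := unit_ramp_ge0 (x - m%:R).
by have := unit_ramp_le1 (x - 0%:R); lra.
Qed.

Lemma tent_ge0 (x : R) : 0 <= tent x.
Proof. by rewrite /tent le_max lexx. Qed.

Lemma tent_lipschitz (x y : R) : `|tent x - tent y| <= `|x - y|.
Proof.
rewrite ler_norml.
have := ler_norm (x - y); have := ler_norm (y - x); rewrite (distrC y x).
have [[? ->]|[? ->]|[? ->]|[? ->]] := tent_cases x;
by have [[? ->]|[? ->]|[? ->]|[? ->]] := tent_cases y; lra.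
Qed.

Lemma big_nat_double (F : nat -> R) m :
  \sum_(0 <= j < m.*2) F j = \sum_(0 <= k < m) (F k.*2 + F k.*2.+1).
Proof.
elim: m => [|m IH]; first by rewrite !big_nil.
by rewrite doubleS !big_nat_recr //= IH addrA.
Qed.

Lemma powR_half_sqr n : (2 `^ (- (n%:R / 2)) : R) ^+ 2 = (2 ^+ n)^-1.
Proof.
rewrite -powR_mulrn ?powR_ge0 // -powRrM mulNr -mulrA mulVf ?pnatr_eq0 // mulr1.
by rewrite powRN powR_mulrn.
Qed.

Section Increments.
Context (p : nat -> R) (n : nat).
Hypothesis p_ndecr : forall i, (i < n)%N -> p i <= p i.+1.
Hypothesis p0_ge0 : 0 <= p 0%N.
Hypothesis pn_le1 : p n <= 1.

Lemma increments_ndecr i j : (i <= j <= n)%N -> p i <= p j.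
Proof.
move=> /andP[]; elim: j => [|j IH]; first by rewrite leqn0 => /eqP ->.
rewrite leq_eqVlt => /orP[/eqP -> //|]; rewrite ltnS => ij jn.
by rewrite (le_trans (IH ij (ltnW jn))) ?p_ndecr.
Qed.

Lemma increments_in01 i : (i <= n)%N -> 0 <= p i <= 1.
Proof.
move=> iln; rewrite (le_trans p0_ge0) ?increments_ndecr //=.
by rewrite (le_trans _ pn_le1) ?increments_ndecr ?iln /=.
Qed.

(** This is the pairing of [f^`()] with the step function equal to [c i]
    on [[p i, p i.+1]]. *)
Definition wincr (c : nat -> R) (f : R -> R) : R :=
  \sum_(0 <= i < n) c i * (f (p i.+1) - f (p i)).

Lemma wincr_lin c f g a b :
  wincr c (fun t => a * f t + b * g t) = a * wincr c f + b * wincr c g.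
Proof.
rewrite /wincr !mulr_sumr -big_split /=; apply: eq_bigr => i _.
by ring.
Qed.

Lemma eq_wincr c f g : f =1 g -> wincr c f = wincr c g.
Proof. by move=> fg; apply: eq_bigr => i _; rewrite !fg. Qed.

(** The squared norm of the projection of the step function [c] on the functions
    that are constant on the dyadic intervals of level [m]. *)
Definition ramp_energy (c : nat -> R) (m : nat) : R :=
  (2 ^+ m)^-1 * \sum_(0 <= k < 2 ^ m)
     wincr c (fun t => unit_ramp (2 ^+ m * t - k%:R)) ^+ 2.

(** A dyadic interval of level [m] and its Haar function are, up to scaling, the
    sum and the difference of the two halves of the interval; this is the
    parallelogram identity. *)
Lemma ramp_energyS c m : ramp_energy c m.+1 = ramp_energy c m +
  \sum_(0 <= k < 2 ^ m) wincr c (faber_schauder m k) ^+ 2.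
Proof.
rewrite /ramp_energy expnS mul2n big_nat_double !mulr_sumr -big_split /=.
apply: eq_bigr => k _.
set A := wincr c (fun t => unit_ramp (2 ^+ m.+1 * t - k.*2%:R)).
set B := wincr c (fun t => unit_ramp (2 ^+ m.+1 * t - k.*2.+1%:R)).
have E1 t : 2 * (2 ^+ m * t - k%:R) = 2 ^+ m.+1 * t - k.*2%:R :> R.
  by rewrite exprS -muln2 natrM; ring.
have E2 t : 2 * (2 ^+ m * t - k%:R) - 1 = 2 ^+ m.+1 * t - k.*2.+1%:R :> R.
  by rewrite E1 -natr1; ring.
have -> : wincr c (fun t => unit_ramp (2 ^+ m * t - k%:R)) = 2^-1 * A + 2^-1 * B.
  by rewrite -wincr_lin; apply: eq_wincr => t; rewrite unit_ramp_half E2 E1 mulrDr.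
have -> : wincr c (faber_schauder m k) =
    2 `^ (- (m%:R / 2)) * 2^-1 * A + - (2 `^ (- (m%:R / 2)) * 2^-1) * B.
  rewrite -wincr_lin; apply: eq_wincr => t.
  by rewrite /faber_schauder tent_half E2 E1; ring.
have -> : (2 `^ (- (m%:R / 2)) * 2^-1 * A + - (2 `^ (- (m%:R / 2)) * 2^-1) * B) ^+ 2
  = (2 `^ (- (m%:R / 2)) : R) ^+ 2 * (2^-1 * (A - B)) ^+ 2 by ring.
rewrite powR_half_sqr exprS invfM.
by field; rewrite expf_neq0 ?pnatr_eq0.
Qed.

(** Parseval's identity for the Haar system, truncated at a dyadic level; the
    [0]-th energy belongs to the constant Haar function. *)
Lemma sum_wincr_faber_schauder c N :
  \sum_(0 <= m < N) \sum_(0 <= k < 2 ^ m) wincr c (faber_schauder m k) ^+ 2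
  = ramp_energy c N - ramp_energy c 0.
Proof.
elim: N => [|N IH]; first by rewrite big_nil subrr.
by rewrite big_nat_recr //= IH ramp_energyS; ring.
Qed.

Lemma ramp_energy_ge0 c m : 0 <= ramp_energy c m.
Proof.
by rewrite mulr_ge0 ?invr_ge0 ?exprn_ge0 // sumr_ge0 // => k _; rewrite sqr_ge0.
Qed.

Lemma sum_unit_ramp_dyadic m i : (i <= n)%N ->
  \sum_(0 <= k < 2 ^ m) unit_ramp (2 ^+ m * p i - k%:R) = 2 ^+ m * p i.
Proof.
move=> iln; have /andP[pi0 pi1] := increments_in01 iln.
rewrite sum_unit_ramp ?mulr_ge0 ?exprn_ge0 // natrX minEle.
by rewrite ler_piMr ?exprn_ge0.
Qed.

(** Cauchy--Schwarz on each dyadic interval, weighted by the lengths of its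
    intersections with the [[p i, p i.+1]]: averaging contracts the norm. *)
Lemma ramp_energy_le c m :
  ramp_energy c m <= \sum_(0 <= i < n) c i ^+ 2 * (p i.+1 - p i).
Proof.
pose w k i := unit_ramp (2 ^+ m * p i.+1 - k%:R) - unit_ramp (2 ^+ m * p i - k%:R).
have w0 k i : (i < n)%N -> 0 <= w k i.
  move=> iln; rewrite subr_ge0 le_unit_ramp // lerB // ler_wpM2l ?exprn_ge0 //.
  exact: p_ndecr.
have step k : wincr c (fun t => unit_ramp (2 ^+ m * t - k%:R)) ^+ 2 <=
    \sum_(0 <= i < n) c i ^+ 2 * w k i.
  pose w' i := if (i < n)%N then w k i else 0.
  have w'0 i : 0 <= w' i by rewrite /w'; case: ifP => //; exact: w0.
  have ww' i : (0 <= i < n)%N -> w k i = w' i by rewrite /w' /= => ->.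
  have := cauchy_schwarz_sum (index_iota 0 n) c (fun=> 1) w'0.
  rewrite (_ : \sum_(i <- _) w' i * c i * 1 =
      wincr c (fun t => unit_ramp (2 ^+ m * t - k%:R))); last first.
    by apply: eq_big_nat => i iln; rewrite -ww' // mulr1 mulrC.
  move=> /le_trans; apply.
  rewrite (_ : \sum_(0 <= i < n) w' i * c i ^+ 2 =
      \sum_(0 <= i < n) c i ^+ 2 * w k i); last first.
    by apply: eq_big_nat => i iln; rewrite -ww' // mulrC.
  apply: ler_piMr.
    by rewrite big_nat_cond sumr_ge0 // => i /andP[/andP[_ iln] _]; rewrite mulr_ge0 ?sqr_ge0 ?w0.
  under eq_big_nat => i iln do rewrite -ww' // expr1n mulr1.
  rewrite /w (telescope_sumr (fun i => unit_ramp (2 ^+ m * p i - k%:R))) //.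
  have := unit_ramp_ge0 (2 ^+ m * p 0%N - k%:R).
  by have := unit_ramp_le1 (2 ^+ m * p n - k%:R); lra.
apply: (@le_trans _ _ ((2 ^+ m)^-1 *
    \sum_(0 <= k < 2 ^ m) \sum_(0 <= i < n) c i ^+ 2 * w k i)).
  by rewrite ler_wpM2l ?invr_ge0 ?exprn_ge0 // ler_sum.
rewrite exchange_big /= mulr_sumr; apply: ler_sum_nat => i /andP[_ iln].
rewrite -mulr_sumr /w sumrB (sum_unit_ramp_dyadic m iln).
rewrite (sum_unit_ramp_dyadic m (ltnW iln)) -mulrBr.
by rewrite mulrCA mulKf ?expf_neq0 ?pnatr_eq0.
Qed.

(** Dropping the constant Haar function turns Parseval's identity into Bessel's
    inequality. *)
Lemma wincr_bessel c N :
  \sum_(0 <= m < N) \sum_(0 <= k < 2 ^ m) wincr c (faber_schauder m k) ^+ 2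
  <= \sum_(0 <= i < n) c i ^+ 2 * (p i.+1 - p i).
Proof.
rewrite sum_wincr_faber_schauder (le_trans _ (ramp_energy_le c N)) //.
by rewrite gerDl oppr_le0 ramp_energy_ge0.
Qed.

End Increments.

(** The variance of an increment of the bridge over [[u, v]] is
    [(v - u) - (v - u) ^+ 2]; truncation costs only the dyadic intervals that
    contain [u] or [v]. *)
Lemma increment_variance (u v : R) N : 0 <= u -> u <= v -> v <= 1 ->
  `| \sum_(0 <= m < N) \sum_(0 <= k < 2 ^ m)
       (faber_schauder m k v - faber_schauder m k u) ^+ 2
     - ((v - u) - (v - u) ^+ 2) | <= 2 * (2 ^+ N)^-1.
Proof.
move=> u0 uv v1.
pose p i := if i is 0%N then u else v.
have pn i : (i < 1)%N -> p i <= p i.+1 by case: i.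
have wE f : wincr p 1 (fun=> 1) f = f v - f u.
  by rewrite /wincr big_nat1 mul1r.
have := sum_wincr_faber_schauder p 1 (fun=> 1) N.
under eq_bigr do under eq_bigr do rewrite wE.
move=> ->.
have -> : ramp_energy p 1 (fun=> 1) 0 = (v - u) ^+ 2.
  rewrite /ramp_energy expr0 expn0 invr1 mul1r big_nat1 wE !mul1r !subr0.
  congr (_ ^+ 2); have [[? ->]|[? ->]|[? ->]] := unit_ramp_cases v;
  by have [[? ->]|[? ->]|[? ->]] := unit_ramp_cases u; lra.
have -> : forall x y z : R, x - z - (y - z) = x - y by move=> *; ring.
set D := (2 ^+ N)^-1; set M : R := 2 ^+ N.
have D0 : 0 < D by rewrite invr_gt0 exprn_gt0.
have DM : D * M = 1 by rewrite mulVf // expf_neq0 ?pnatr_eq0.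
pose a k := unit_ramp (M * u - k%:R); pose b k := unit_ramp (M * v - k%:R).
have vuE : v - u = D * \sum_(0 <= k < 2 ^ N) (b k - a k).
  rewrite sumrB (sum_unit_ramp_dyadic pn u0 v1 N (leqnn 1)).
  by rewrite (sum_unit_ramp_dyadic pn u0 v1 N (leq0n 1)) -mulrBr mulrA DM mul1r.
rewrite {1}/ramp_energy distrC {1}vuE -/D -mulrBr -sumrB.
under eq_bigr do rewrite wE -/M -/(a _) -/(b _).
have ab k : a k <= b k.
  by apply: le_unit_ramp; rewrite lerB // ler_wpM2l // exprn_ge0.
have H k : 0 <= b k - a k - (b k - a k) ^+ 2 <= a k * (1 - a k) + b k * (1 - b k).
  have := ab k; have := unit_ramp_ge0 (M * u - k%:R); have := unit_ramp_le1 (M * v - k%:R).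
  rewrite -/(a k) -/(b k); move: (a k) (b k) => x y *.
  apply/andP; split; nra.
rewrite ger0_norm; last first.
  by rewrite mulr_ge0 ?(ltW D0) // sumr_ge0 // => k _; case/andP: (H k).
rewrite mulrC ler_wpM2r ?(ltW D0) //.
apply: (@le_trans _ _ (\sum_(0 <= k < 2 ^ N) (a k * (1 - a k) + b k * (1 - b k)))).
  by apply: ler_sum => k _; case/andP: (H k).
rewrite big_split /= -[X in _ <= X]/(1 + 1).
by rewrite lerD ?sum_unit_ramp_defect.
Qed.

End FaberSchauderIncrements.

(** * Refinement of partitions *)

Section GramMatrices.
Context {R : realType}.

(** The sequence [p 0, ..., p n] is obtained from [p' 0, ..., p' n'] by merging
    consecutive intervals: [b j] is the coarse interval containing the [j]-th
    fine one. Quantifying over [F] makes this apply at once to lengths and to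
    increments of Faber--Schauder functions. *)
Definition coarsens (p : nat -> R) (n : nat) (p' : nat -> R) (n' : nat) : Prop :=
  exists b : nat -> nat, (forall j, (j < n')%N -> (b j < n)%N) /\
    forall (F : R -> R) i, (i < n)%N ->
      F (p i.+1) - F (p i) = \sum_(0 <= j < n' | b j == i) (F (p' j.+1) - F (p' j)).

(** Bessel's inequality passes to tensor products: apply it in each of the two
    variables in turn. *)
Lemma tensor_bessel (I : finType) (a : nat -> I -> R) (n : nat) (l : nat -> R) :
  (forall i, (i < n)%N -> 0 <= l i) ->
  (forall c : nat -> R, \sum_q (\sum_(0 <= i < n) c i * a i q) ^+ 2 <=
     \sum_(0 <= i < n) c i ^+ 2 * l i) ->
  forall c : nat -> nat -> R,
  \sum_q \sum_r (\sum_(0 <= i < n) \sum_(0 <= j < n) c i j * (a i q * a j r)) ^+ 2 <=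
  \sum_(0 <= i < n) \sum_(0 <= j < n) c i j ^+ 2 * (l i * l j).
Proof.
move=> l0 bessel c; rewrite exchange_big /=.
apply: (@le_trans _ _ (\sum_r \sum_(0 <= i < n) (\sum_(0 <= j < n) c i j * a j r) ^+ 2 * l i)).
  apply: ler_sum => r _.
  have -> : \sum_q (\sum_(0 <= i < n) \sum_(0 <= j < n) c i j * (a i q * a j r)) ^+ 2 =
    \sum_q (\sum_(0 <= i < n) (\sum_(0 <= j < n) c i j * a j r) * a i q) ^+ 2.
    apply: eq_bigr => q _; congr (_ ^+ 2); apply: eq_bigr => i _.
    by rewrite mulr_suml; apply: eq_bigr => j _; ring.
  exact: bessel.
rewrite exchange_big /=; apply: ler_sum_nat => i /andP[_ iln].
rewrite -mulr_suml.
have -> : \sum_(0 <= j < n) c i j ^+ 2 * (l i * l j) =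
    (\sum_(0 <= j < n) c i j ^+ 2 * l j) * l i.
  by rewrite mulr_suml; apply: eq_bigr => j _; ring.
by rewrite ler_wpM2r ?l0.
Qed.

Definition fs_index (N : nat) : finType := {m : 'I_N & 'I_(2 ^ m)}.

Lemma sum_fs_index N (F : nat -> nat -> R) :
  \sum_(q : fs_index N) F (tag q) (tagged q) =
  \sum_(0 <= m < N) \sum_(0 <= k < 2 ^ m) F m k.
Proof.
rewrite big_mkord; under [RHS]eq_bigr do rewrite big_mkord.
by rewrite sig_big_dep.
Qed.

Definition fs_incr (p : nat -> R) N (i : nat) (q : fs_index N) : R :=
  faber_schauder (tag q) (tagged q) (p i.+1) - faber_schauder (tag q) (tagged q) (p i).

(** The matrix of the sum of the squared increments of the truncated path, as a
    quadratic form in the signs. *)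
Definition gram (p : nat -> R) (n N : nat) (q r : fs_index N) : R :=
  \sum_(0 <= i < n) fs_incr p i q * fs_incr p i r.

Definition sum_sqr_length (p : nat -> R) (n : nat) : R :=
  \sum_(0 <= i < n) (p i.+1 - p i) ^+ 2.

Definition subdivision01 (p : nat -> R) (n : nat) : Prop :=
  [/\ forall i, (i < n)%N -> p i <= p i.+1, 0 <= p 0%N & p n <= 1].

Lemma gramC p n N (q r : fs_index N) : gram p n q r = gram p n r q.
Proof. by apply: eq_bigr => i _; rewrite mulrC. Qed.

Lemma tensor_fs_bessel p n N (c : nat -> nat -> R) : subdivision01 p n ->
  \sum_(q : fs_index N) \sum_(r : fs_index N)
    (\sum_(0 <= i < n) \sum_(0 <= j < n) c i j * (fs_incr p i q * fs_incr p j r)) ^+ 2 <=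
  \sum_(0 <= i < n) \sum_(0 <= j < n) c i j ^+ 2 *
      ((p i.+1 - p i) * (p j.+1 - p j)).
Proof.
move=> [pn p0 p1].
apply: (tensor_bessel (l := fun i => p i.+1 - p i)).
  by move=> i /pn; rewrite subr_ge0.
move=> c'; have := wincr_bessel pn p0 p1 c' N.
by rewrite -sum_fs_index.
Qed.

(** The kernel equal to [1] on the squares [[p i, p i.+1] ^ 2] has squared norm
    [sum_sqr_length p n], and [gram] consists of some of its coefficients in an
    orthonormal basis. *)
Lemma gram_hilbert_schmidt p n N : subdivision01 p n ->
  \sum_(q : fs_index N) \sum_(r : fs_index N) gram p n q r ^+ 2 <= sum_sqr_length p n.
Proof.
move=> pP; have := @tensor_fs_bessel p n N (fun i j => (i == j)%:R) pP.
have delta (G : nat -> nat -> R) i : (i < n)%N ->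
    \sum_(0 <= j < n) (i == j)%:R * G i j = G i i.
  move=> iln; rewrite (bigD1_seq i) ?mem_index_iota ?iota_uniq //= eqxx mul1r.
  by rewrite big1 ?addr0 // => j ij; rewrite eq_sym (negPf ij) mul0r.
congr (_ <= _).
  apply: eq_bigr => q _; apply: eq_bigr => r _; congr (_ ^+ 2).
  by apply: eq_big_nat => i iln; rewrite (delta (fun i j => fs_incr p i q * fs_incr p j r)).
apply: eq_big_nat => i iln.
rewrite expr2 -(delta (fun i j => (p i.+1 - p i) * (p j.+1 - p j))) //.
by apply: eq_bigr => j _; case: eqP => _; rewrite ?expr1n ?expr0n.
Qed.

(** As a kernel on [[0, 1] ^ 2], the difference is the indicator function of
    the union of the rectangles [I j * I j'], for [j != j'] such that the fine
    intervals [I j] and [I j'] lie in the same coarse interval; [c] is the matrix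
    of its values. *)
Lemma gram_refine_hilbert_schmidt p n p' n' N :
  subdivision01 p' n' -> coarsens p n p' n' ->
  \sum_(q : fs_index N) \sum_(r : fs_index N) (gram p n q r - gram p' n' q r) ^+ 2 <=
  sum_sqr_length p n - sum_sqr_length p' n'.
Proof.
move=> p'P [b [bn bE]].
pose c j k : R := (b j == b k)%:R - (j == k)%:R.
have blocks (u v : nat -> R) :
    \sum_(0 <= i < n) (\sum_(0 <= j < n' | b j == i) u j) *
                      (\sum_(0 <= j < n' | b j == i) v j) -
    \sum_(0 <= j < n') u j * v j =
    \sum_(0 <= j < n') \sum_(0 <= k < n') c j k * (u j * v k).
  transitivity (\sum_(0 <= j < n') \sum_(0 <= k < n') (b j == b k)%:R * (u j * v k)
      - \sum_(0 <= j < n') \sum_(0 <= k < n') (j == k)%:R * (u j * v k)); last first.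
    rewrite -sumrB; apply: eq_bigr => j _; rewrite -sumrB.
    by apply: eq_bigr => k _; rewrite mulrBl.
  congr (_ - _); last first.
    apply: eq_big_nat => j jn.
    rewrite (bigD1_seq j) ?mem_index_iota ?iota_uniq //= eqxx mul1r.
    by rewrite big1 ?addr0 // => k kj; rewrite eq_sym (negPf kj) mul0r.
  under eq_bigr do rewrite big_distrlr big_mkcond /=.
  rewrite exchange_big /=; apply: eq_big_nat => j /andP[_ jn].
  rewrite (bigD1_seq (b j)) ?mem_index_iota ?iota_uniq ?bn //= eqxx.
  rewrite [X in _ + X]big1 ?addr0; last first.
    by move=> i ij; rewrite eq_sym (negPf ij).
  rewrite big_mkcond /=; apply: eq_bigr => k _.
  by rewrite eq_sym; case: eqP => _; rewrite ?mul1r ?mul0r.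
(* [c j k] is [0] or [1], because [j == k] implies [b j == b k] *)
have c01 j k : c j k ^+ 2 = c j k.
  rewrite /c; case: (eqVneq j k) => [->|_]; first by rewrite eqxx subrr expr0n.
  by rewrite subr0; case: eqP => _; rewrite ?expr1n ?expr0n.
have -> : sum_sqr_length p n - sum_sqr_length p' n' =
    \sum_(0 <= j < n') \sum_(0 <= k < n') c j k ^+ 2 *
      ((p' j.+1 - p' j) * (p' k.+1 - p' k)).
  under eq_bigr do under eq_bigr do rewrite c01.
  rewrite -blocks; congr (_ - _).
  by apply: eq_big_nat => i /andP[_ iln]; rewrite (bE id) // expr2.
apply: le_trans (tensor_fs_bessel N c p'P).
rewrite le_eqVlt; apply/orP; left; apply/eqP.
apply: eq_bigr => q _; apply: eq_bigr => r _; congr (_ ^+ 2).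
rewrite -blocks; congr (_ - _); apply: eq_big_nat => i /andP[_ iln].
by rewrite /fs_incr !(bE (faber_schauder _ _)).
Qed.

Lemma sum_sqr_length_le_coarse p n p' n' :
  subdivision01 p' n' -> coarsens p n p' n' ->
  sum_sqr_length p' n' <= sum_sqr_length p n.
Proof.
move=> p'P pp'; rewrite -subr_ge0.
apply: le_trans (gram_refine_hilbert_schmidt 0 p'P pp').
by apply: sumr_ge0 => q _; apply: sumr_ge0 => r _; rewrite sqr_ge0.
Qed.

Lemma gram_trace p n N : subdivision01 p n ->
  `| \sum_(q : fs_index N) gram p n q q - (p n - p 0%N - sum_sqr_length p n) | <=
  2 * n%:R * (2 ^+ N)^-1.
Proof.
move=> [pn p0 p1]; rewrite exchange_big /= -(telescope_sumr p) // /sum_sqr_length.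
rewrite -!sumrB; apply: le_trans (ler_norm_sum _ _ _) _.
have -> : 2 * n%:R * (2 ^+ N)^-1 = \sum_(0 <= i < n) 2 * (2 ^+ N)^-1 :> R.
  by rewrite sumr_const_nat subn0 -mulr_natl; ring.
apply: ler_sum_nat => i /andP[_ iln].
have := @increment_variance R (p i) (p i.+1) N.
rewrite -sum_fs_index /=; under eq_bigr do rewrite expr2.
apply; rewrite ?pn //.
  by case/andP: (increments_in01 pn p0 p1 (ltnW iln)).
by case/andP: (increments_in01 pn p0 p1 iln).
Qed.

End GramMatrices.

Section StoppedPartitions.
Context {R : realType}.
Implicit Types (s : seq R) (t : R).

(** In terms of indices: [phi i] is the position in the fine partition of the
    [i]-th point of the coarse one. *)
Lemma coarsens_index (p : nat -> R) n (p' : nat -> R) n' (phi : nat -> nat) :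
  phi 0%N = 0%N -> phi n = n' ->
  (forall i, (i < n)%N -> (phi i < phi i.+1)%N) ->
  (forall i, (i <= n)%N -> p i = p' (phi i)) ->
  coarsens p n p' n'.
Proof.
move=> phi0 phin phiS pE.
have phi_le i j : (i <= j)%N -> (j <= n)%N -> (phi i <= phi j)%N.
  elim: j => [|j IH]; first by rewrite leqn0 => /eqP ->.
  rewrite leq_eqVlt => /orP[/eqP -> //|]; rewrite ltnS => ij jn.
  by rewrite (leq_trans (IH ij (ltnW jn))) // ltnW // phiS.
pose b j := find (fun i => (j < phi i.+1)%N) (iota 0 n).
have bP j : (j < n')%N -> (b j < n)%N /\ (phi (b j) <= j < phi (b j).+1)%N.
  move=> jn.
  have n0 : (0 < n)%N by case: (n) phin phi0 jn => // -> ->.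
  have hb : has (fun i => (j < phi i.+1)%N) (iota 0 n).
    apply/hasP; exists n.-1; first by rewrite mem_iota /= add0n prednK.
    by rewrite prednK // phin.
  have bn : (b j < n)%N by move: (hb); rewrite has_find size_iota.
  split=> //; have := nth_find 0%N hb; rewrite -/(b j) nth_iota // add0n => ->.
  rewrite andbT; case E : (b j) => [|i]; first by rewrite phi0.
  have := @before_find _ 0%N (fun i => (j < phi i.+1)%N) (iota 0 n) i.
  rewrite -/(b j) E ltnSn nth_iota ?add0n; last by rewrite ltnW // -E.
  by move=> /(_ isT); rewrite ltnNge => /negbFE.
exists b; split=> [j /bP[]//|F i iln].
have bE j : (j < n')%N -> (b j == i) = (phi i <= j < phi i.+1)%N.
  move=> jn; have [bn /andP[b1 b2]] := bP j jn.
  apply/eqP/andP => [<- //|[i1 i2]]; apply/eqP; rewrite eqn_leq; apply/andP; split.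
    rewrite leqNgt; apply/negP => ib.
    by have := leq_trans (leq_trans i2 (phi_le _ _ ib (ltnW bn))) b1; rewrite ltnn.
  rewrite leqNgt; apply/negP => ib.
  by have := leq_trans (leq_trans b2 (phi_le _ _ ib (ltnW iln))) i1; rewrite ltnn.
rewrite (pE _ (ltnW iln)) (pE _ iln).
rewrite -(telescope_sumr (F \o p')) ?phi_le //=.
have phin' : (phi i.+1 <= n')%N by rewrite -phin phi_le.
rewrite [RHS](big_cat_nat (n := phi i)) //=; last first.
  by rewrite (leq_trans _ phin') // phi_le.
rewrite [X in _ = X + _]big_nat_cond [X in _ = X + _]big1 ?add0r; last first.
  move=> j /andP[/andP[_ jphi]].
  rewrite bE; last by rewrite (leq_trans jphi) // (leq_trans _ phin') // phi_le.
  by rewrite leqNgt jphi.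
rewrite [RHS](big_cat_nat (n := phi i.+1)) ?phi_le //=.
rewrite [X in _ = _ + X]big_nat_cond [X in _ = _ + X]big1 ?addr0; last first.
  move=> j /andP[/andP[phij jn']].
  by rewrite bE // ltnNge phij andbF.
rewrite big_nat_cond [RHS]big_nat_cond; apply: eq_bigl => j; rewrite andbT.
case: (boolP (phi i <= j < phi i.+1)%N) => //= jphi.
have /andP[_ j2] := jphi.
by rewrite bE // (leq_trans j2).
Qed.

Lemma partition_lt s i j : itv_partition 0 1 s -> (i < j <= size s)%N ->
  (0 :: s)`_i < (0 :: s)`_j.
Proof.
move=> [sP _] /andP[ij js].
have : sorted <%O (0 :: s) by [].
by move/(lt_sorted_ltn_nth 0) => -> //; rewrite inE /= ltnS // (leq_trans (ltnW ij)).
Qed.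

Lemma partition_last s : itv_partition 0 1 s -> (0 :: s)`_(size s) = 1.
Proof. exact: itv_partition_nth_size. Qed.

Definition stopped_partition s t (i : nat) : R := Num.min (0 :: s)`_i t.

Lemma stopped_partition0 s t : 0 <= t -> stopped_partition s t 0 = 0.
Proof. by move=> t0; rewrite /stopped_partition /= min_l. Qed.

Lemma stopped_partition_last s t : itv_partition 0 1 s -> t <= 1 ->
  stopped_partition s t (size s) = t.
Proof. by move=> sP t1; rewrite /stopped_partition partition_last // min_r. Qed.

Lemma subdivision01_stopped s t : itv_partition 0 1 s -> 0 <= t <= 1 ->
  subdivision01 (stopped_partition s t) (size s).
Proof.
move=> sP /andP[t0 t1]; split; rewrite ?stopped_partition0 ?stopped_partition_last //.
move=> i iln; have lt : (0 :: s)`_i < (0 :: s)`_i.+1.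
  by apply: partition_lt; rewrite ?ltnSn.
rewrite /stopped_partition le_min !ge_min lexx orbT andbT.
by rewrite (ltW lt).
Qed.

Lemma coarsens_stopped s s' t :
  itv_partition 0 1 s -> itv_partition 0 1 s' -> {subset 0 :: s <= 0 :: s'} ->
  coarsens (stopped_partition s t) (size s) (stopped_partition s' t) (size s').
Proof.
move=> sP s'P sub.
pose phi i := index (0 :: s)`_i (0 :: s').
have mem i : (i <= size s)%N -> (0 :: s)`_i \in 0 :: s'.
  by move=> iln; rewrite sub // mem_nth.
have nth_phi i : (i <= size s)%N -> (0 :: s')`_(phi i) = (0 :: s)`_i.
  by move=> /mem im; rewrite nth_index.
have us' : uniq (0 :: s') by case: s'P => ? _; apply: (lt_sorted_uniq (s := 0 :: s')).
apply: (@coarsens_index _ _ _ _ phi) => [||i iln|i iln].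
- by rewrite /phi /= eqxx.
- by rewrite /phi partition_last // -(partition_last s'P) index_uniq.
- rewrite ltnNge; apply/negP => H.
  have : (0 :: s)`_i < (0 :: s)`_i.+1 by apply: partition_lt; rewrite ?ltnSn.
  rewrite -(nth_phi i) ?(ltnW iln) // -(nth_phi i.+1) // ltNge => /negP; apply.
  move: H; rewrite leq_eqVlt => /orP[/eqP -> //|H]; apply/ltW/partition_lt => //.
  by rewrite H /= -ltnS [(size s').+1]/(size (0 :: s')) index_mem mem // ltnW.
- by rewrite /stopped_partition nth_phi.
Qed.

Lemma mesh_ge s i : (i < size s)%N -> (0 :: s)`_i.+1 - (0 :: s)`_i <= mesh s.
Proof.
move=> iln; rewrite /mesh big_mkord.
rewrite -[i]/(val (Ordinal iln)).
by rewrite (le_bigmax_cond _ (fun i : 'I__ => (0 :: s)`_i.+1 - (0 :: s)`_i)).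
Qed.

Lemma mesh_ge0 s : 0 <= mesh s.
Proof. by rewrite /mesh bigmax_ge_id. Qed.

Lemma stopped_incr_le s t i : itv_partition 0 1 s -> (i < size s)%N ->
  stopped_partition s t i.+1 - stopped_partition s t i <= mesh s.
Proof.
move=> sP iln; apply: le_trans (mesh_ge iln).
have lt : (0 :: s)`_i < (0 :: s)`_i.+1 by apply: partition_lt; rewrite ?ltnSn.
rewrite /stopped_partition.
by case: (lerP (0 :: s)`_i t) => ?; case: (lerP (0 :: s)`_i.+1 t) => ?; lra.
Qed.

Lemma sum_sqr_length_ge0 (p : nat -> R) n : 0 <= sum_sqr_length p n.
Proof. by apply: sumr_ge0 => i _; rewrite sqr_ge0. Qed.

Lemma sum_sqr_length_le_mesh s t : itv_partition 0 1 s -> 0 <= t <= 1 ->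
  sum_sqr_length (stopped_partition s t) (size s) <= mesh s.
Proof.
move=> sP t01; have [pn _ _] := subdivision01_stopped sP t01.
have /andP[t0 t1] := t01.
apply: (@le_trans _ _ (\sum_(0 <= i < size s)
   mesh s * (stopped_partition s t i.+1 - stopped_partition s t i))).
  apply: ler_sum_nat => i /andP[_ iln].
  by rewrite expr2 ler_wpM2r ?stopped_incr_le // subr_ge0 pn.
rewrite -mulr_sumr telescope_sumr // stopped_partition0 // stopped_partition_last //.
by rewrite subr0 ler_piMr ?mesh_ge0.
Qed.

End StoppedPartitions.

(** * Events determined by finitely many signs *)

Section SignPatterns.
Context {d : measure_display} {T : measurableType d} {R : realType}.
Context (P : probability T R).

Lemma measurable_RV_eq (X : {RV P >-> R}) (a : R) : measurable (X @^-1` [set a]).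
Proof. by rewrite -[X in measurable X]setTI; exact: measurable_funPT. Qed.

Lemma rademacher_sgn_of (X : {RV P >-> R}) b : rademacher X ->
  P (X @^-1` [set sgn_of b]) = (2^-1)%:E.
Proof. by case: b => -[]. Qed.

Lemma rademacher_negligible (X : {RV P >-> R}) : rademacher X ->
  P.-negligible [set w | ~ (X w = 1 \/ X w = -1)].
Proof.
move=> [X1 XN1]; have m1 := measurable_RV_eq X 1; have mN1 := measurable_RV_eq X (-1).
have mU := measurableU _ _ m1 mN1.
exists (~` (X @^-1` [set 1] `|` X @^-1` [set -1])); split => //.
- exact: measurableC.
- rewrite probability_setC // measureU //.
    transitivity (1%:E - ((2^-1)%:E + (2^-1)%:E) : \bar R)%E.
      by congr (1 - (_ + _))%E; [exact: X1|exact: XN1].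
    have h : 2^-1 + 2^-1 = 1 :> R by field.
    by rewrite -EFinD h subrr.
  by apply/seteqP; split => // w [/= ->] h; have := ltrN10 R; rewrite -h ltr10.
Qed.

Lemma measure_bigsetU_le (I : Type) (s : seq I) (F : I -> set T) (c : R) :
  (forall i, measurable (F i)) -> (forall i, (P (F i) <= c%:E)%E) ->
  (P (\big[setU/set0]_(i <- s) F i) <= ((size s)%:R * c)%:E)%E.
Proof.
move=> mF Fc; elim: s => [|i s IH]; first by rewrite big_nil measure0 mul0r.
rewrite big_cons; apply: le_trans (measureU2 _ _ _) _ => //.
  exact: bigsetU_measurable.
by rewrite /= -nat1r mulrDl mul1r EFinD leeD.
Qed.

Lemma measure_liminf_le (B : nat -> set T) (c : R) :
  (forall n, measurable (B n)) -> (forall n, (P (B n) <= c%:E)%E) ->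
  (P (\bigcup_N \bigcap_(n in [set n | (N <= n)%N]) B n) <= c%:E)%E.
Proof.
move=> mB Bc; set F := fun N => \bigcap_(n in [set n | (N <= n)%N]) B n.
have mF N : measurable (F N) by apply: bigcap_measurable => //; exists N => /=.
have FC : P \o F @ \oo --> P (\bigcup_N F N).
  apply: nondecreasing_cvg_mu => //; first exact: bigcupT_measurable.
  move=> m n mn; apply/subsetPset => w Fw k /= nk; apply: Fw => /=.
  exact: leq_trans mn nk.
rewrite -(cvg_lim _ FC) //; apply: lime_le; first by apply/cvg_ex; exists (P (\bigcup_N F N)).
near=> N; apply: le_trans (Bc N); apply: le_measure; rewrite ?inE //.
by move=> w; apply => /=.
Unshelve. all: by end_near. Qed.

Section Patterns.
Context {K : choiceType} (X : K -> {RV P >-> R}).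
Hypothesis Xrad : forall k, rademacher (X k).
Hypothesis Xind : mutually_independent X.
Context {I : finType} (iota : I -> K).
Hypothesis iota_inj : injective iota.

Definition sign_cylinder (e : {ffun I -> bool}) : set T :=
  [set w | forall i, X (iota i) w = sgn_of (e i)].

Definition sign_event (A : {set {ffun I -> bool}}) : set T :=
  \big[setU/set0]_(e <- enum A) sign_cylinder e.

Lemma sign_cylinderE e :
  sign_cylinder e = \big[setI/setT]_(i <- enum I) (X (iota i) @^-1` [set sgn_of (e i)]).
Proof.
rewrite -bigcap_seq; apply/seteqP; split => w H i; first by move=> _; exact: H.
by apply: H; rewrite /= mem_enum.
Qed.

Lemma measurable_sign_cylinder e : measurable (sign_cylinder e).
Proof.
rewrite sign_cylinderE; apply: bigsetI_measurable => i _.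
exact: measurable_RV_eq.
Qed.

Lemma measure_sign_cylinder e : P (sign_cylinder e) = (2^-1 ^+ #|I|)%:E.
Proof.
pose J : {fset K} := [fset iota i | i in I]%fset.
pose B k := if [pick i | iota i == k] is Some i then [set sgn_of (e i)] else (setT : set R).
have BE i : B (iota i) = [set sgn_of (e i)].
  rewrite /B; case: pickP => [j /eqP /iota_inj -> //|/(_ i)].
  by rewrite eqxx.
have mB k : measurable (B k) by rewrite /B; case: pickP.
have -> : sign_cylinder e = \bigcap_(k in [set` J]) (X k @^-1` B k).
  apply/seteqP; split => w.
    by move=> H k /= /imfsetP[i _ ->]; rewrite /preimage BE /=; exact: H.
  move=> H i; have := H (iota i); rewrite /preimage /= BE; apply.
  by apply/imfsetP; exists i.
rewrite Xind // big_imfset /=; last by move=> i j _ _; exact: iota_inj.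
under eq_bigr do rewrite BE rademacher_sgn_of //.
rewrite prodEFin; congr (_%:E); rewrite big_const_seq count_predT.
by rewrite iter_mulr_1 cardE.
Qed.

Lemma measurable_sign_event A : measurable (sign_event A).
Proof. by apply: bigsetU_measurable => e _; exact: measurable_sign_cylinder. Qed.

(** By independence all the cylinders have the same probability as under the
    uniform measure; conclude by subadditivity. *)
Lemma measure_sign_event A :
  (P (sign_event A) <= (#|A|%:R / #|{ffun I -> bool}|%:R)%:E)%E.
Proof.
rewrite /sign_event cardE.
apply: (@measure_bigsetU_le _ (enum A)) => e; first exact: measurable_sign_cylinder.
by rewrite measure_sign_cylinder card_ffun card_bool natrX exprVn.
Qed.

Lemma sign_eventP (A : {set {ffun I -> bool}}) w (e : {ffun I -> bool}) :
  e \in A -> (forall i, X (iota i) w = sgn_of (e i)) -> sign_event A w.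
Proof.
by move=> eA H; rewrite /sign_event -bigcup_seq; exists e => //=; rewrite mem_enum.
Qed.

End Patterns.

Lemma rademacher_all_negligible (K : countType) (X : K -> {RV P >-> R}) :
  (forall k, rademacher (X k)) ->
  P.-negligible [set w | ~ forall k, X k w = 1 \/ X k w = -1].
Proof.
move=> Xrad.
pose F m := if choice.unpickle m is Some k then [set w | ~ (X k w = 1 \/ X k w = -1)] else set0.
apply: (@negligibleS _ _ _ _ (\bigcup_m F m)); last first.
  apply: negligible_bigcup => m; rewrite /F; case: (choice.unpickle m : option K) => [k|].
    exact: rademacher_negligible.
  exact: negligible_set0.
move=> w /existsNP[k Hk]; exists (choice.pickle k) => //.
by rewrite /F choice.pickleK.
Qed.

End SignPatterns.

(** * Continuity of the sample paths *)

Section SamplePaths.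
Context {R : realType}.

(** The bound on the tails depends only on [q]: applied to the levels of the
    path, it is uniform in time and in the signs. *)
Lemma geometric_tail (u : nat -> R) (q : R) : 0 <= q < 1 ->
  (forall n, `|u n| <= q ^+ n) ->
  series u @ \oo --> limn (series u) /\
  forall N, `|limn (series u) - series u N| <= q ^+ N / (1 - q).
Proof.
move=> /andP[q0 q1] uq.
have q1' : 0 < 1 - q by rewrite subr_gt0.
have cu : cvgn (series u).
  apply: normed_cvg; apply: (@series_le_cvg _ _ (geometric 1 q)).
  - by move=> n; exact: normr_ge0.
  - by move=> n; rewrite /geometric /= mul1r exprn_ge0.
  - by move=> n; rewrite /geometric /= mul1r.
  - by apply: is_cvg_geometric_series; rewrite ger0_norm.
split=> // N.
have bound M : (N <= M)%N -> `|series u M - series u N| <= q ^+ N / (1 - q).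
  move=> NM; rewrite sub_series_geq //.
  apply: le_trans (ler_norm_sum _ _ _) _.
  apply: (@le_trans _ _ (\sum_(N <= k < M) (- (q ^+ k.+1 / (1 - q)) - - (q ^+ k / (1 - q))))).
    apply: ler_sum => k _; apply: le_trans (uq k) _.
    rewrite le_eqVlt; apply/orP; left; apply/eqP; rewrite exprS; field.
    by rewrite gt_eqF.
  rewrite (telescope_sumr (fun k => - (q ^+ k / (1 - q)))) //.
  by rewrite opprK addrC gerDl oppr_le0 divr_ge0 ?exprn_ge0 // ltW.
have cN : (fun M => `|series u M - series u N|) @ \oo --> `|limn (series u) - series u N|.
  by apply: cvg_norm; apply: cvgB => //; exact: cvg_cst.
rewrite -(cvg_lim _ cN) //; apply: limr_le; first by apply/cvg_ex; eexists; exact: cN.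
by near=> M; apply: bound; near: M; exists N.
Unshelve. all: by end_near. Qed.

Context (eps : forall n : nat, 'I_(2 ^ n) -> R).
Arguments eps : clear implicits.
Hypothesis eps_le1 : forall n k, `|eps n k| <= 1.

Definition fs_level (n : nat) (t : R) : R := \sum_(k < 2 ^ n) eps n k * faber_schauder n k t.

Definition fs_path (t : R) : R := limn (series (fs_level ^~ t)).

Definition fs_partial (N : nat) (t : R) : R := series (fs_level ^~ t) N.

Lemma faber_schauder_ge0 n k (t : R) : 0 <= faber_schauder n k t.
Proof. by rewrite mulr_ge0 ?powR_ge0 ?tent_ge0. Qed.

Let q : R := 2 `^ (- 2^-1).

Lemma q01 : 0 <= q < 1.
Proof.
have q2 : q ^+ 2 = 2^-1.
  by have := @powR_half_sqr R 1; rewrite mul1r expr1.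
rewrite powR_ge0 /= ltNge; apply/negP => q1.
by have := exprn_ege1 2 q1; rewrite q2 invf_ge1 // (ler_nat _ 2 1).
Qed.

Lemma powR_half n : (2 : R) `^ (- (n%:R / 2)) = q ^+ n.
Proof. by rewrite -powR_mulrn ?powR_ge0 // -powRrM mulNr mulrC. Qed.

(** The functions of one level have essentially disjoint supports. *)
Lemma fs_level_le n t : `|fs_level n t| <= q ^+ n.
Proof.
apply: le_trans (ler_norm_sum _ _ _) _.
apply: (@le_trans _ _ (\sum_(k < 2 ^ n) faber_schauder n k t)).
  apply: ler_sum => k _; rewrite normrM (ger0_norm (faber_schauder_ge0 _ _ _)).
  by rewrite ler_piMl ?faber_schauder_ge0.
rewrite /faber_schauder -mulr_sumr powR_half.
rewrite -(big_mkord xpredT (fun k => tent (2 ^+ n * t - k%:R))).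
by rewrite ler_piMr ?sum_tent_le1 // exprn_ge0 //; case/andP: q01.
Qed.

Lemma fs_partial_cvg t : fs_partial ^~ t @ \oo --> fs_path t.
Proof. by have [] := geometric_tail q01 (fs_level_le ^~ t). Qed.

Lemma faber_schauder_lipschitz n k (s t : R) :
  `|faber_schauder n k s - faber_schauder n k t| <= 2 ^+ n * `|s - t|.
Proof.
rewrite /faber_schauder -mulrBr normrM ger0_norm ?powR_ge0 //.
apply: (@le_trans _ _ `|tent (2 ^+ n * s - k%:R) - tent (2 ^+ n * t - k%:R)|).
  rewrite ler_piMl // powR_half exprn_ile1 //; by case/andP: q01 => // ? /ltW.
apply: le_trans (tent_lipschitz _ _) _.
rewrite (_ : 2 ^+ n * s - k%:R - (2 ^+ n * t - k%:R) = 2 ^+ n * (s - t)); last by ring.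
by rewrite normrM ger0_norm ?exprn_ge0.
Qed.

Lemma fs_partial_lipschitz N (s t : R) :
  `|fs_partial N s - fs_partial N t| <=
  (\sum_(0 <= n < N) \sum_(k < 2 ^ n) 2 ^+ n) * `|s - t|.
Proof.
rewrite /fs_partial /series /= -sumrB mulr_suml.
apply: le_trans (ler_norm_sum _ _ _) _; apply: ler_sum => n _.
rewrite /fs_level -sumrB mulr_suml.
apply: le_trans (ler_norm_sum _ _ _) _; apply: ler_sum => k _.
rewrite -mulrBr normrM; apply: le_trans (faber_schauder_lipschitz n k s t).
by rewrite ler_piMl.
Qed.

(** The partial sums are Lipschitz and approximate the path uniformly. *)
Lemma fs_path_unif_continuous e : 0 < e -> exists2 delta, 0 < delta &
  forall s t, `|s - t| < delta -> `|fs_path s - fs_path t| <= e.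
Proof.
move=> e0; have /andP[q0 q1] := q01.
have q1' : 0 < 1 - q by rewrite subr_gt0.
have [N HN] : exists N, q ^+ N / (1 - q) <= e / 3.
  have : (fun N => q ^+ N) @ \oo --> (0 : R) by apply: cvg_expr; rewrite ger0_norm.
  move/cvgrPdist_le => /(_ (e / 3 * (1 - q))) /=.
  rewrite mulr_gt0 ?divr_gt0 // => /(_ isT)[N _ HN]; exists N.
  have := HN N (leqnn N) => /=; rewrite sub0r normrN ger0_norm ?exprn_ge0 //.
  by rewrite ler_pdivrMr.
set L := \sum_(0 <= n < N) \sum_(k < 2 ^ n) 2 ^+ n : R.
have L0 : 0 <= L by apply: sumr_ge0 => n _; apply: sumr_ge0 => k _; rewrite exprn_ge0.
have L1 : 0 < L + 1 by rewrite ltr_wpDl.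
exists (e / 3 / (L + 1)); first by rewrite !divr_gt0.
move=> s t st.
have T u : `|fs_path u - fs_partial N u| <= e / 3.
  by have [_ /(_ N)] := geometric_tail q01 (fs_level_le ^~ u); move/le_trans; apply.
have Lst : `|fs_partial N s - fs_partial N t| <= e / 3.
  apply: le_trans (fs_partial_lipschitz N s t) _; rewrite -/L.
  apply: (@le_trans _ _ ((L + 1) * `|s - t|)); first by rewrite ler_wpM2r // lerDl.
  by rewrite mulrC -ler_pdivlMr // ltW.
have -> : fs_path s - fs_path t = (fs_path s - fs_partial N s) +
  (fs_partial N s - fs_partial N t) - (fs_path t - fs_partial N t) by ring.
apply: le_trans (ler_normB _ _) _.
apply: (@le_trans _ _ (e / 3 + e / 3 + e / 3)).
  by rewrite lerD // (le_trans (ler_normD _ _)) // lerD.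
by rewrite le_eqVlt; apply/orP; left; apply/eqP; field.
Qed.

End SamplePaths.

(** * Almost sure convergence at a fixed time *)

Section RefiningSequence.
Context {R : realType} (pi : nat -> seq R).
Hypothesis hpi : refining_partitions pi.
Context (t : R).
Hypothesis t01 : 0 <= t <= 1.

Let p m := stopped_partition (pi m) t.
Let n m := size (pi m).
Let S m := sum_sqr_length (p m) (n m).

Lemma refining_subdivision m : subdivision01 (p m) (n m).
Proof. by case: hpi => H _ _; exact: subdivision01_stopped. Qed.

Lemma refining_coarsens m m' : (m <= m')%N -> coarsens (p m) (n m) (p m') (n m').
Proof.
case: hpi => H sub _ mm'; apply: coarsens_stopped => //.
elim: m' mm' => [|m' IH]; first by rewrite leqn0 => /eqP ->.
rewrite leq_eqVlt => /orP[/eqP -> //|]; rewrite ltnS => /IH mm' x xm.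
exact/sub/mm'.
Qed.

Lemma refining_sum_sqr_length_le m m' : (m <= m')%N -> S m' <= S m.
Proof.
move=> mm'; apply: sum_sqr_length_le_coarse; first exact: refining_subdivision.
exact: refining_coarsens.
Qed.

Definition gram_chaos (N m : nat) (e : {ffun fs_index N -> bool}) : R :=
  \sum_(q : fs_index N) \sum_(r : fs_index N)
     gram (p m) (n m) q r * (sgn_of (e q) * sgn_of (e r)) -
  \sum_(q : fs_index N) gram (p m) (n m) q q.

(** The bound on [Z] depends neither on [N] nor on [m1], which is what allows the
    passage to the limit. Chaining from [m0] bounds the increments after [m0],
    and hypercontractivity bounds the value at [m0] itself. *)
Lemma gram_chaos_maximal N m0 m1 : (m0 <= m1)%N ->
  exists Z : {ffun fs_index N -> bool} -> R, [/\ forall e, 0 <= Z e,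
    forall e m, (m0 <= m <= m1)%N -> gram_chaos m e ^+ 4 <= Z e &
    sign_mean Z <= 2 ^+ 21 * S m0 ^+ 2].
Proof.
move=> m01.
have incr m m' : (m <= m')%N ->
    sign_mean (fun e => (gram_chaos (N := N) m' e - gram_chaos m e) ^+ 4) <=
    18 ^+ 2 * (S m - S m') ^+ 2.
  move=> mm'.
  pose A (q r : fs_index N) : R := gram (p m) (n m) q r - gram (p m') (n m') q r.
  have Asym q r : A q r = A r q by rewrite /A !(gramC _ _ q).
  have := @quadratic_form_quart R (fs_index N) A Asym.
  have -> : sign_mean (fun e => (\sum_q \sum_r A q r * (sgn_of (e q) * sgn_of (e r)) -
      \sum_q A q q) ^+ 4) =
      sign_mean (fun e => (gram_chaos (N := N) m' e - gram_chaos m e) ^+ 4).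
    have quartN (x y : R) : (x - y) ^+ 4 = (y - x) ^+ 4 by ring.
    apply: eq_sign_mean => e; rewrite [RHS]quartN.
    congr (_ ^+ 4); rewrite /gram_chaos /A.
    rewrite !sumrB; under eq_bigr do under eq_bigr do rewrite mulrBl.
    under eq_bigr do rewrite sumrB; rewrite sumrB.
    by ring.
  move/le_trans; apply; rewrite ler_wpM2l ?exprn_ge0 // ler_pXn2r ?nnegrE //.
  - exact: gram_refine_hilbert_schmidt (refining_subdivision _) (refining_coarsens mm').
  - by apply: sumr_ge0 => q _; apply: sumr_ge0 => r _; rewrite sqr_ge0.
  - by rewrite subr_ge0 refining_sum_sqr_length_le.
have [|Z [Z0 ZP Zm]] := @sign_mean_maximal R (fs_index N) (@gram_chaos N) S (18 ^+ 2) m0 m1 _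
  refining_sum_sqr_length_le incr m01; first exact: exprn_ge0.
have S0 m : 0 <= S m by apply: sum_sqr_length_ge0.
exists (fun e => 2 ^+ 9 * gram_chaos m0 e ^+ 4 + 3 / 2 * Z e); split.
- move=> e; apply: addr_ge0.
    by apply: mulr_ge0; [exact: exprn_ge0|exact: exprn_even_ge0].
  by rewrite mulr_ge0 ?divr_ge0.
- move=> e m mm; have -> : gram_chaos m e = gram_chaos m0 e + (gram_chaos m e - gram_chaos m0 e).
    by ring.
  apply: le_trans (quartD_le _ _) _.
  by rewrite lerD2l ler_wpM2l ?ZP // divr_ge0 // ler0n.
rewrite sign_meanD !sign_meanZ.
(* [2 ^+ 21] exceeds [2 ^+ 9 * 18 ^+ 2 + 3 / 2 * (2 ^+ 11 * 18 ^+ 2)] *)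
have q0 : sign_mean (fun e => gram_chaos (N := N) m0 e ^+ 4) <= 18 ^+ 2 * S m0 ^+ 2.
  have /le_trans := @quadratic_form_quart R (fs_index N) (@gram R (p m0) (n m0) N)
    (@gramC R (p m0) (n m0) N).
  apply.
  rewrite ler_wpM2l ?exprn_ge0 // ler_pXn2r ?nnegrE //.
    by apply: gram_hilbert_schmidt; exact: refining_subdivision.
  by apply: sumr_ge0 => q _; apply: sumr_ge0 => r _; rewrite sqr_ge0.
have S2 : (S m0 - S m1) ^+ 2 <= S m0 ^+ 2.
  rewrite ler_pXn2r ?nnegrE ?subr_ge0 ?refining_sum_sqr_length_le //.
  by rewrite gerBl.
move: q0 S2 Zm (sqr_ge0 (S m0)); move: (sign_mean _) (sign_mean _) (S m0 ^+ 2) ((S m0 - S m1) ^+ 2).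
by move=> *; lra.
Qed.

Section FixedTime.
Context {d : measure_display} {T : measurableType d} (P : probability T R).
Context (theta : forall n : nat, 'I_(2 ^ n) -> {RV P >-> R}).
Arguments theta : clear implicits.
Hypothesis htheta : independent_rademacher theta.

Definition all_signs (w : T) : Prop := forall n k, theta n k w = 1 \/ theta n k w = -1.

Lemma all_signs_negligible : P.-negligible [set w | ~ all_signs w].
Proof.
have [rad _] := htheta.
have := @rademacher_all_negligible _ _ _ P {n : nat & 'I_(2 ^ n)}
  (fun i => theta (tag i) (tagged i)) (fun i => rad _ _).
apply: negligibleS => w /= Hw H; apply: Hw => k l.
exact: (H (Tagged (fun n => 'I_(2 ^ n)) l)).
Qed.

Definition partial_quadratic_sum (N m : nat) (w : T) : R :=
  stopped_quadratic_sum (fs_partial (fun n k => theta n k w) N) (pi m) t.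

Lemma partial_quadratic_sumE N m w :
  partial_quadratic_sum N m w =
  \sum_(q : fs_index N) \sum_(r : fs_index N) gram (p m) (n m) q r *
    (theta (tag q) (tagged q) w * theta (tag r) (tagged r) w).
Proof.
have partialE u : fs_partial (fun n k => theta n k w) N u =
    \sum_(q : fs_index N) theta (tag q) (tagged q) w *
       faber_schauder (tag q) (tagged q) u.
  rewrite /fs_partial /series /= big_mkord /fs_level.
  by rewrite sig_big_dep.
transitivity (\sum_(0 <= i < n m) \sum_(q : fs_index N) \sum_(r : fs_index N)
   (theta (tag q) (tagged q) w * fs_incr (p m) i q) *
   (theta (tag r) (tagged r) w * fs_incr (p m) i r)).
  apply: eq_bigr => i _; rewrite !partialE -sumrB expr2 big_distrlr /=.
  apply: eq_bigr => q _; apply: eq_bigr => r _.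
  by congr (_ * _); rewrite /fs_incr [RHS]mulrBr.
rewrite exchange_big; apply: eq_bigr => q _; rewrite exchange_big.
apply: eq_bigr => r _; rewrite mulr_suml; apply: eq_bigr => i _.
by ring.
Qed.

(** Markov's inequality for the bound [Z] of [gram_chaos_maximal]; the mesh
    controls the sum of the squared lengths. *)
Lemma truncated_bad_event (eta : R) N m0 m1 : 0 < eta -> (m0 <= m1)%N ->
  exists B : set T, [/\ measurable B,
    (P B <= (2 ^+ 21 * mesh (pi m0) ^+ 2 / eta)%:E)%E &
    forall w m, all_signs w -> (m0 <= m <= m1)%N ->
      eta < (partial_quadratic_sum N m w -
             \sum_(q : fs_index N) gram (p m) (n m) q q) ^+ 4 -> B w].
Proof.
move=> eta0 m01; have [Z [Z0 ZP Zm]] := gram_chaos_maximal N m01.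
have [rad ind] := htheta.
pose X (i : {n : nat & 'I_(2 ^ n)}) := theta (tag i) (tagged i).
pose iota (q : fs_index N) : {n : nat & 'I_(2 ^ n)} :=
  Tagged (fun n => 'I_(2 ^ n)) (tagged q : 'I_(2 ^ (tag q : nat))).
have iota_inj : injective iota.
  move=> [a i] [b j]; rewrite /iota /= => E.
  have ab : a = b by apply: val_inj; exact: (congr1 tag E).
  subst b; congr existT; move/eqP: E; rewrite eq_Tagged /=.
  by move/eqP.
exists (sign_event X iota [set e | eta < Z e]%SET); split.
- exact: measurable_sign_event.
- have radX i : rademacher (X i) by exact: rad.
  apply: le_trans (measure_sign_event radX ind iota_inj _) _.
  rewrite lee_fin; apply: le_trans (sign_mean_markov Z0 eta0) _.
  rewrite ler_wpM2r ?invr_ge0 ?(ltW eta0) //; apply: le_trans Zm _.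
  rewrite ler_wpM2l ?exprn_ge0 // ler_pXn2r ?nnegrE ?mesh_ge0 //; last first.
    exact: sum_sqr_length_ge0.
  by case: hpi => H _ _; exact: sum_sqr_length_le_mesh.
- move=> w m ws mm etaw.
  pose e : {ffun fs_index N -> bool} :=
    [ffun q : fs_index N => theta (tag q) (tagged q) w == 1].
  have eE (q : fs_index N) : theta (tag q) (tagged q) w = sgn_of (e q).
    rewrite ffunE; case: (ws (tag q) (tagged q)) => ->; first by rewrite eqxx.
    by rewrite lt_eqF // (lt_trans (ltrN10 R)) ?ltr01.
  apply: (sign_eventP (e := e)) => //.
  rewrite inE; apply: lt_le_trans (ZP e m mm); move: etaw.
  rewrite partial_quadratic_sumE /gram_chaos.
  by under eq_bigr do under eq_bigr do rewrite !eE.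
Qed.

(** The centering [t - S m] is the limit of the trace of [gram] as the truncation
    level grows, not [t] itself. *)
Definition centered_quadratic_sum (m : nat) (w : T) : R :=
  stopped_quadratic_sum (takagi_landsberg theta w) (pi m) t - (t - S m).

Lemma all_signs_le1 w : all_signs w -> forall n k, `|theta n k w| <= 1.
Proof. by move=> ws k l; case: (ws k l) => ->; rewrite ?normrN normr1. Qed.

Lemma partial_quadratic_sum_cvg m w : all_signs w ->
  (fun N => partial_quadratic_sum N m w - \sum_(q : fs_index N) gram (p m) (n m) q q)
    @ \oo --> centered_quadratic_sum m w.
Proof.
move=> ws; apply: cvgB.
  rewrite /partial_quadratic_sum /stopped_quadratic_sum.
  apply: cvg_big => [|i _]; first exact: add_continuous.
  under eq_fun do rewrite expr2.
  by apply: cvgM; apply: cvgB; exact: fs_partial_cvg (all_signs_le1 ws) _.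
have Ht : t - S m = p m (n m) - p m 0%N - sum_sqr_length (p m) (n m).
  have /andP[t0 t1] := t01; case: hpi => H _ _.
  by rewrite /p stopped_partition_last // stopped_partition0 // subr0.
rewrite Ht; apply/cvgrPdist_le => e e0.
have c0 : (fun N => 2 * (n m)%:R * (2^-1) ^+ N) @ \oo --> (0 : R).
  rewrite -[X in _ --> X](mulr0 (2 * (n m)%:R)); apply: cvgM; first exact: cvg_cst.
  by apply: cvg_expr; rewrite ger0_norm ?invf_lt1 ?ltr1n ?invr_ge0.
move/cvgrPdist_le : c0 => /(_ e e0); apply: filterS => N /=.
rewrite sub0r normrN ger0_norm; last by rewrite !mulr_ge0 ?exprn_ge0 ?invr_ge0.
apply: le_trans; rewrite distrC exprVn.
by apply: gram_trace; exact: refining_subdivision.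
Qed.

(** A deviation for some partition [pi m] with [m0 <= m] is seen by all but
    finitely many of the truncations, so its probability is at most a limit
    inferior, bounded by a constant times the squared mesh of [pi m0]; then let
    [m0] grow. *)
Lemma centered_deviation_negligible (eta : R) : 0 < eta ->
  P.-negligible [set w | all_signs w /\
     forall m0, exists2 m, (m0 <= m)%N & eta < centered_quadratic_sum m w ^+ 4].
Proof.
move=> eta0.
have exB m0 M : exists B : set T, [/\ measurable B,
    (P B <= (2 ^+ 21 * mesh (pi m0) ^+ 2 / eta)%:E)%E &
    forall w m, all_signs w -> (m0 <= m <= m0 + M)%N ->
      eta < (partial_quadratic_sum M m w -
             \sum_(q : fs_index M) gram (p m) (n m) q q) ^+ 4 -> B w].
  by apply: truncated_bad_event => //; exact: leq_addr.
(* letting the truncation level and the last partition grow together leaves a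
   single limit to take *)
pose B m0 M := projT1 (cid (exB m0 M)).
have BP m0 M := projT2 (cid (exB m0 M)).
pose D := \bigcap_m0 \bigcup_N \bigcap_(M in [set M | (N <= M)%N]) B m0 M.
have mL m0 : measurable (\bigcup_N \bigcap_(M in [set M | (N <= M)%N]) B m0 M).
  apply: bigcupT_measurable => N; apply: bigcap_measurable; first by exists N => /=.
  by move=> M _; case: (BP m0 M).
have mD : measurable D by apply: bigcapT_measurable.
exists D; split => //.
- apply/eqP; rewrite eq_le measure_ge0 andbT; apply/lee_addgt0Pr => e e0.
  have c0 : (fun m0 => 2 ^+ 21 * mesh (pi m0) ^+ 2 / eta) @ \oo --> (0 : R).
    case: hpi => _ _ mesh0.
    have -> : (0 : R) = 2 ^+ 21 * (0 * 0) / eta by rewrite !(mulr0, mul0r).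
    apply: cvgM; last exact: cvg_cst; apply: cvgM; first exact: cvg_cst.
    by under eq_fun do rewrite expr2; exact: cvgM.
  move/cvgrPdist_le : c0 => /(_ e e0)[m0 _ /(_ m0 (leqnn m0))] /=.
  rewrite sub0r normrN => /(le_trans (ler_norm _)) le_e.
  rewrite add0e.
  apply: (@le_trans _ _ (2 ^+ 21 * mesh (pi m0) ^+ 2 / eta)%:E); last first.
    by rewrite lee_fin.
  apply: (@le_trans _ _ (P (\bigcup_N \bigcap_(M in [set M | (N <= M)%N]) B m0 M))).
    by apply: le_measure; rewrite ?inE // => w; apply.
  by apply: measure_liminf_le => M; case: (BP m0 M).
- move=> w [ws H] m0 _; have [m m0m etaw] := H m0.
  have c := @partial_quadratic_sum_cvg m w ws.
  have {}c : (fun N => (partial_quadratic_sum N m w -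
      \sum_(q : fs_index N) gram (p m) (n m) q q) ^+ 4) @ \oo -->
      centered_quadratic_sum m w ^+ 4.
    exact: continuous_cvg (@exprn_continuous R 4 _) c.
  have /= [N _ HN] := cvgr_gt _ c _ etaw.
  exists (N + m)%N => // M /= NM; have [_ _ BM] := BP m0 M.
  apply: (BM w m ws).
    by rewrite m0m /= (leq_trans _ (leq_addl _ _)) // (leq_trans _ NM) // leq_addl.
  by apply: HN => /=; rewrite (leq_trans _ NM) // leq_addr.
Qed.

Lemma quadratic_sum_cvg_negligible :
  P.-negligible [set w | all_signs w /\
    ~ (stopped_quadratic_sum (takagi_landsberg theta w) (pi m) t @[m --> \oo] --> t)].
Proof.
apply: (@negligibleS _ _ _ _ (\bigcup_k [set w | all_signs w /\
     forall m0, exists2 m, (m0 <= m)%N & k.+1%:R^-1 < centered_quadratic_sum m w ^+ 4])); last first.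
  by apply: negligible_bigcup => k; apply: centered_deviation_negligible; rewrite invr_gt0.
move=> w [ws nc]; apply: contrapT => nU; apply: nc.
have Hk k : exists m0, forall m, (m0 <= m)%N -> centered_quadratic_sum m w ^+ 4 <= k.+1%:R^-1.
  apply: contrapT => nk; apply: nU; exists k => //; split=> // m0.
  apply: contrapT => nm; apply: nk; exists m0 => m m0m.
  by rewrite leNgt; apply/negP => lt; apply: nm; exists m.
have c0 : centered_quadratic_sum m w @[m --> \oo] --> (0 : R).
  apply/cvgrPdist_le => e e0.
  have [k ke] : exists k, k.+1%:R^-1 <= e ^+ 4.
    have e4 : 0 < e ^+ 4 by rewrite exprn_gt0.
    exists (Num.truncn (e ^+ 4)^-1); rewrite -[leRHS]invrK lef_pV2 ?posrE ?invr_gt0 //.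
    by apply/ltW/truncnS_gt.
  have [m0 H0] := Hk k; exists m0 => // m /= m0m; rewrite sub0r normrN.
  rewrite -(@ler_pXn2r _ 4) ?nnegrE ?normr_ge0 ?(ltW e0) //.
  by rewrite -normrX ger0_norm ?exprn_even_ge0 // (le_trans (H0 m m0m)).
have cS : S m @[m --> \oo] --> (0 : R).
  case: hpi => H _ mesh0; apply: (@squeeze_cvgr _ _ _ _ (cst 0) (fun m => mesh (pi m))).
  - near=> m; rewrite sum_sqr_length_ge0 /=.
    exact: sum_sqr_length_le_mesh.
  - exact: cvg_cst.
  - exact: mesh0.
have -> : (fun m => stopped_quadratic_sum (takagi_landsberg theta w) (pi m) t) =
    (fun m => centered_quadratic_sum m w + (t - S m)).
  by apply/funext => m; rewrite /centered_quadratic_sum subrK.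
rewrite -[X in _ --> X]add0r; apply: cvgD => //.
by rewrite -[X in _ --> X]subr0; apply: cvgB => //; exact: cvg_cst.
Unshelve. all: by end_near. Qed.

End FixedTime.
End RefiningSequence.

(** * Uniformity in time *)

Section Uniformity.
Context {R : realType}.

(** Stopping at [u] instead of [v] only shortens the sum, except that the
    interval containing [u] is cut. *)
Lemma stopped_quadratic_sum_almost_mono (x : R -> R) (s : seq R) (e u v : R) :
  itv_partition 0 1 s -> 0 <= e ->
  (forall a b, `|a - b| <= mesh s -> (x a - x b) ^+ 2 <= e) ->
  u <= v -> stopped_quadratic_sum x s u <= stopped_quadratic_sum x s v + e.
Proof.
move=> sP e0 osc uv.
pose M := \sum_(0 <= i < size s)
  ((x (Num.min (0 :: s)`_i.+1 v) - x (Num.min (0 :: s)`_i v)) ^+ 2 +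
   (- (e * ((0 :: s)`_i.+1 < u)%R%:R) - - (e * ((0 :: s)`_i < u)%R%:R))).
apply: (@le_trans _ _ M).
  apply: ler_sum_nat => i /andP[_ iln].
  have ab := partition_lt sP (_ : (i < i.+1 <= size s)%N); rewrite ltnSn iln in ab.
  move: {ab}(ab isT) (mesh_ge iln).
  move: (0 :: s)`_i (0 :: s)`_i.+1 => a b ab abm.
  have [ub|bu] := ltP u b; last first.
    rewrite !(min_l (_ : b <= _)) ?(le_trans bu) //.
    rewrite !(min_l (_ : a <= _)) ?(le_trans (ltW ab)) ?(le_trans bu) //.
    by rewrite lerDl (lt_le_trans ab bu); case: ltP => _; rewrite /= ?mulr1 ?mulr0; lra.

  rewrite (ltNge b) (ltW ub) /=; have [ua|au] := leP u a.
    by rewrite subrr expr0n mulr0 subrr addr0 sqr_ge0.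
  have eu : (x u - x a) ^+ 2 <= e.
    by apply: osc; rewrite gtr0_norm ?subr_gt0 //; lra.
  by rewrite mulr1 mulr0 oppr0 add0r opprK (le_trans eu) // lerDr sqr_ge0.
rewrite /M big_split /= lerD2l (telescope_sumr (fun i => - (e * ((0 :: s)`_i < u)%R%:R))) //.
by case: ltP => _; case: ltP => _; rewrite ?mulr1 ?mulr0; lra.
Qed.

(** The argument of Dini and Polya: monotone functions converging on a fine grid
    to a continuous function are uniformly close to it. Here the monotonicity
    holds up to an error [e / 3] given by the oscillation of [x]. *)
Lemma uniform_of_pointwise (x : R -> R) (pi : nat -> seq R) :
  refining_partitions pi ->
  (forall e : R, 0 < e -> exists2 delta, 0 < delta &
     forall s t, `|s - t| < delta -> `|x s - x t| <= e) ->
  (forall K k, (k <= K.+1)%N ->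
     stopped_quadratic_sum x (pi m) (k%:R / K.+1%:R) @[m --> \oo] --> (k%:R / K.+1%:R : R)) ->
  forall e : R, 0 < e -> \forall m \near \oo, forall t : R, 0 <= t <= 1 ->
    `|stopped_quadratic_sum x (pi m) t - t| <= e.
Proof.
move=> [piP _ mesh0] xuc ptw e e0.
have e3 : 0 < e / 3 by rewrite divr_gt0.
have [K Ke] : exists K, K.+1%:R^-1 <= e / 3.
  exists (Num.truncn (e / 3)^-1).
  rewrite -[leRHS]invrK lef_pV2 ?posrE ?invr_gt0 //.
  by apply/ltW/truncnS_gt.
pose c := Num.min 1 (e / 3).
have c0 : 0 < c by rewrite lt_min ltr01 e3.
have c1 : c <= 1 by rewrite ge_min lexx.
have ce : c <= e / 3 by rewrite ge_min lexx orbT.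
have [delta delta0 xd] := xuc c c0.
have grid : \forall m \near \oo, forall k : 'I_K.+2,
    `|k%:R / K.+1%:R - stopped_quadratic_sum x (pi m) (k%:R / K.+1%:R)| <= e / 3.
  apply: filter_forall => k.
  by have /cvgrPdist_le := ptw K k (ltn_ord k : (k <= K.+1)%N); apply.
have small : \forall m \near \oo, mesh (pi m) < delta.
  exact: cvgr_lt mesh0 _ delta0.
near=> m => t /andP[t0 t1].
have grid_m : forall k : nat, (k <= K.+1)%N ->
    `|k%:R / K.+1%:R - stopped_quadratic_sum x (pi m) (k%:R / K.+1%:R)| <= e / 3.
  move=> k kK; have H : forall k : 'I_K.+2,
    `|k%:R / K.+1%:R - stopped_quadratic_sum x (pi m) (k%:R / K.+1%:R)| <= e / 3.
    by near: m.
  exact: (H (Ordinal (kK : (k < K.+2)%N))).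
have osc a b : `|a - b| <= mesh (pi m) -> (x a - x b) ^+ 2 <= e / 3.
  move=> abm; apply: le_trans ce; rewrite -real_normK ?num_real //.
  have /xd xab : `|a - b| < delta by apply: le_lt_trans abm _; near: m.
  apply: (@le_trans _ _ (c ^+ 2)); last by rewrite expr2 ler_piMl // ltW.
  by rewrite ler_pXn2r ?nnegrE // ltW.
have K0 : 0 < K.+1%:R :> R by rewrite ltr0n.
have [k kK /andP[kt tk]] : exists2 k, (k <= K)%N & k%:R / K.+1%:R <= t <= k.+1%:R / K.+1%:R.
  have exk : exists k, t <= k.+1%:R / K.+1%:R by exists K; rewrite divff ?gt_eqF.
  case: (ex_minnP exk) => k tk kmin; exists k; first by rewrite kmin // divff ?gt_eqF.
  rewrite tk andbT; case: k kmin {tk} => [|k] kmin; first by rewrite mul0r.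
  by rewrite leNgt; apply/negP => /ltW/kmin; rewrite ltnn.
have step : k.+1%:R / K.+1%:R = k%:R / K.+1%:R + K.+1%:R^-1 :> R.
  by rewrite -natr1 mulrDl mul1r.
have := grid_m k (leqW kK); have := grid_m k.+1 kK.
have := stopped_quadratic_sum_almost_mono (piP m) (ltW e3) osc kt.
have := stopped_quadratic_sum_almost_mono (piP m) (ltW e3) osc tk.
move: Ke kt tk; rewrite step !ler_norml.
move: (stopped_quadratic_sum _ _ _) (stopped_quadratic_sum _ _ _) (stopped_quadratic_sum _ _ _).
move: (K.+1%:R^-1) (k%:R / _) => *; apply/andP; split; lra.
Unshelve. all: by end_near. Qed.

Lemma ereal_sup_cvg0 (f : nat -> R -> R) :
  (forall m t, 0 <= f m t) ->
  (forall e : R, 0 < e -> \forall m \near \oo, forall t : R, 0 <= t <= 1 -> f m t <= e) ->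
  ereal_sup [set (f m t)%:E | t in `[0, 1]%classic] @[m --> \oo] --> 0%E.
Proof.
move=> f0 small.
have ge0 m : (0 <= ereal_sup [set (f m t)%:E | t in `[0%R, 1%R]%classic])%E.
  apply: (@le_trans _ _ (f m 0)%:E); first by rewrite lee_fin.
  by apply: ereal_sup_ubound; exists 0 => //=; rewrite in_itv /= lexx ler01.
have le m (e : R) : (forall t : R, 0 <= t <= 1 -> f m t <= e) ->
    (ereal_sup [set (f m t)%:E | t in `[0%R, 1%R]%classic] <= e%:E)%E.
  move=> H; apply: ge_ereal_sup => _ [t /= t01 <-]; rewrite lee_fin; apply: H.
  by move: t01; rewrite in_itv.
have fin : \forall m \near \oo, ereal_sup [set (f m t)%:E | t in `[0, 1]%classic] \is a fin_num.
  apply: filterS (small 1 ltr01) => m /le H.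
  by rewrite ge0_fin_numE // (le_lt_trans H) // ltry.
apply/fine_cvgP; split=> //; apply/cvgrPdist_le => e e0.
near=> m; rewrite sub0r normrN ger0_norm ?fine_ge0 //.
have fm : ereal_sup [set (f m t)%:E | t in `[0, 1]%classic] \is a fin_num by near: m.
rewrite -lee_fin fineK //; apply: le; near: m; exact: small.
Unshelve. all: by end_near. Qed.

End Uniformity.


Unset Implicit Arguments.

Theorem theorem2p4 (R : realType) (d : measure_display) (T : measurableType d)
    (P : probability T R)
    (theta : forall n : nat, 'I_(2 ^ n)%N -> {RV P >-> R})
    (htheta : independent_rademacher theta)
    (pi : nat -> seq R) (hpi : refining_partitions pi) :
  exists Omega_pi : set T,
    [/\ measurable Omega_pi,
        P Omega_pi = 1%E
      & forall w : T, Omega_pi w ->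
          ereal_sup [set (`| stopped_quadratic_sum
                               (takagi_landsberg theta w) (pi m) t - t |)%:E
                    | t in `[0, 1]%classic] @[m --> \oo] --> 0%E].
Proof.
pose bad K k := [set w | (k <= K.+1)%N /\ all_signs theta w /\
  ~ (stopped_quadratic_sum (takagi_landsberg theta w) (pi m) (k%:R / K.+1%:R)
       @[m --> \oo] --> (k%:R / K.+1%:R : R))].
have neg : P.-negligible ([set w | ~ all_signs theta w] `|` \bigcup_K \bigcup_k bad K k).
  apply: negligibleU; first exact: all_signs_negligible.
  apply: negligible_bigcup => K; apply: negligible_bigcup => k.
  have [kK|Kk] := leqP k K.+1; last first.
    apply: negligibleS (negligible_set0 P) => w [].
    by rewrite leqNgt Kk.
  have t01 : 0 <= (k%:R / K.+1%:R : R) <= 1.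
    by rewrite divr_ge0 //= ler_pdivrMr ?ltr0n // mul1r ler_nat.
  apply: negligibleS (quadratic_sum_cvg_negligible hpi t01 htheta) => w [_ []].
  by [].
case: neg => A [mA PA badA].
exists (~` A); split; first exact: measurableC.
  by rewrite probability_setC // PA sube0.
move=> w Aw.
have ws : all_signs theta w by apply: contrapT => nw; apply: Aw; apply: badA; left.
apply: ereal_sup_cvg0 => [m t|]; first exact: normr_ge0.
apply: uniform_of_pointwise => //.
  exact: fs_path_unif_continuous (all_signs_le1 ws).
move=> K k kK; apply: contrapT => nc; apply: Aw; apply: badA; right.
by exists K => //; exists k.
Qed.
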